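(* Up to rigid motions of $\mathbb{L}^3$, the only Riemann ZMC examples foliated by circles with constant radii contained in spacelike planes are parametrized by $$X(z,v)=z(-r^2\vec a,1)+r(\cos v,\sin v,0),$$ where $z,v\in\mathbb{R}$, $\vec a\in\mathbb{R}^2\setminus\{0\}$ and $r>0$ is the radius of the circles. The surfaces are timelike and can be extended to two lightlike straight lines.
   Context: $\mathbb{L}^3$ is $\mathbb{R}^3$ with the metric $\langle,\rangle=dx_1^2+dx_2^2-dx_3^2$; $\mathbb{R}^2$ is identified with the plane $x_3=0$. A surface or plane is spacelike, timelike or lightlike where the induced metric is Riemannian, Lorentzian or degenerate; a straight line is lightlike if its direction $\vec v\ne0$ satisfies $\langle\vec v,\vec v\rangle=0$. The mean curvature $H$ is defined where the induced metric of a surface is non-degenerate; zero mean curvature (ZMC) means $H=0$. A circle is a non-degenerate planar curve of nonzero constant curvature; in planes $x_3=\text{const}$ circles are Euclidean circles. A Riemann ZMC example is a non-rotational surface with zero mean curvature foliated by pieces of circles contained in parallel planes; after a rigid motion (isometry of $\mathbb{L}^3$) the planes are taken parallel to $x_3=0$.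
   Formalization: Not every a≠0, r>0 gives a zero mean curvature surface (a=(2,0), r=1 fails); the formal theorem proves that every such example is a piece of some X, and that X is a Riemann ZMC example exactly when r²|a|=1. *)

(* Defs.v *)
From HB Require Import structures.
From mathcomp Require Import all_boot all_order all_algebra.
From mathcomp Require Import all_classical all_reals all_analysis.

Set Implicit Arguments.
Unset Strict Implicit.
Unset Printing Implicit Defensive.

Import Order.TTheory GRing.Theory Num.Theory numFieldNormedType.Exports.

Local Open Scope classical_set_scope.
Local Open Scope ring_scope.

(* Lorentz-Minkowski space: row vectors of size 3; the coordinates x_1, x_2,
   x_3 have indices 0, 1, 2. *)

Section LorentzMinkowski.
Context {R : realType}.
Implicit Types (x y d : 'rV[R]_3) (V L : set 'rV[R]_3).

Definition vec3 (a b c : R) : 'rV[R]_3 := \row_i [:: a; b; c]`_i.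

Definition lorentz x y : R :=
  x 0 0 * y 0 0 + x 0 1 * y 0 1 - x 0 2 * y 0 2.

(* lorentz (lcross x y) z is the determinant of (x, y, z). *)
Definition lcross x y : 'rV[R]_3 :=
  vec3 (x 0 1 * y 0 2 - x 0 2 * y 0 1)
       (x 0 2 * y 0 0 - x 0 0 * y 0 2)
       (- (x 0 0 * y 0 1 - x 0 1 * y 0 0)).

Definition lorentz_isometry (B : 'M[R]_3) : Prop :=
  forall x y, lorentz (x *m B) (y *m B) = lorentz x y.

Definition rigid_motion (Phi : 'rV[R]_3 -> 'rV[R]_3) : Prop :=
  exists B b, lorentz_isometry B /\ Phi = (fun x => x *m B + b).

(* Causal character of a two-dimensional space of vectors V. *)

Definition spacelike V : Prop := forall x, V x -> x != 0 -> 0 < lorentz x x.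

Definition timelike V : Prop :=
  exists x y, [/\ V x, V y, lorentz x y = 0, lorentz x x < 0 & 0 < lorentz y y].

Definition degenerate V : Prop :=
  exists x, [/\ V x, x != 0 & forall y, V y -> lorentz x y = 0].

Definition orthogonal_plane (nu : 'rV[R]_3) : set 'rV[R]_3 :=
  [set x | lorentz x nu = 0].

Definition lightlike_line L : Prop :=
  exists p d, [/\ d != 0, lorentz d d = 0 & L = [set p + t *: d | t in setT]].

(* The circle of centre c and radius rho in the plane through c with normal nu,
   for the metric induced on that plane, which is positive definite when the
   plane is spacelike. *)
Definition circle (nu c : 'rV[R]_3) (rho : R) : set 'rV[R]_3 :=
  [set x | lorentz (x - c) nu = 0 /\ lorentz (x - c) (x - c) = rho ^+ 2].

End LorentzMinkowski.

(* Local differential geometry of a parametrization X : R -> R -> 'rV_3. *)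

Section Parametrizations.
Context {R : realType}.
Implicit Types (X : R -> R -> 'rV[R]_3) (u v : R).

Definition du X : R -> R -> 'rV[R]_3 := fun u v => derive1 (X^~ v) u.
Definition dv X : R -> R -> 'rV[R]_3 := fun u v => derive1 (X u) v.

(* The iterated partial derivative of X along a word in u (true), v (false). *)
Definition partial (w : seq bool) X : R -> R -> 'rV[R]_3 :=
  foldr (fun (b : bool) Y => if b then du Y else dv Y) X w.

(* C^infinity on the open set D. *)
Definition smooth_on (D : set (R * R)) X : Prop :=
  forall (w : seq bool) (q : R * R), D q ->
    [/\ {for q, continuous (fun q' : R * R => partial w X q'.1 q'.2)},
        derivable ((partial w X)^~ q.2) q.1 1 &
        derivable (partial w X q.1) q.2 1].

Definition regular_at X u v : Prop := row_free (col_mx (du X u v) (dv X u v)).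

Definition tangent X u v : set 'rV[R]_3 :=
  [set a *: du X u v + b *: dv X u v | a in setT & b in setT].

Definition unit_normal X u v : 'rV[R]_3 :=
  let n := lcross (du X u v) (dv X u v) in (Num.sqrt `|lorentz n n|)^-1 *: n.

(* H N is half the trace of the vector-valued second fundamental form; the
   factor <N, N> = 1 or -1 comes from <H N, N> = H <N, N>. *)
Definition mean_curvature X u v : R :=
  let E := lorentz (du X u v) (du X u v) in
  let F := lorentz (du X u v) (dv X u v) in
  let G := lorentz (dv X u v) (dv X u v) in
  let N := unit_normal X u v in
  let e := lorentz N (du (du X) u v) in
  let f := lorentz N (du (dv X) u v) in
  let g := lorentz N (dv (dv X) u v) in
  lorentz N N * ((e * G - 2 * f * F + g * E) / (2 * (E * G - F ^+ 2))).

End Parametrizations.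

(* A chart of M is a map from the product chart_u x chart_v. *)
Record chart (R : realType) (M : Type) := Chart {
  chart_u : set R;
  chart_v : set R;
  chart_map : R -> R -> M }.

Definition id_chart (R : realType) : chart R (R * R)%type :=
  Chart setT setT (fun u v => (u, v)).

Section ImmersedSurfaces.
Context {R : realType} {M : topologicalType}.
Implicit Types (f : M -> 'rV[R]_3) (phi : chart R M) (A : set (chart R M)).

Definition chart_dom phi : set (R * R) := chart_u phi `*` chart_v phi.

Definition chart_image phi : set M :=
  [set chart_map phi q.1 q.2 | q in chart_dom phi].

Definition in_chart f phi : R -> R -> 'rV[R]_3 :=
  fun u v => f (chart_map phi u v).

(* phi is a homeomorphism from an open rectangle, possibly unbounded, onto an
   open subset of M, and f is a smooth immersion when read in phi. *)
Definition immersive_chart f phi : Prop :=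
  let phi2 := fun q : R * R => chart_map phi q.1 q.2 in
  [/\ [/\ open (chart_u phi), is_interval (chart_u phi),
          open (chart_v phi) & is_interval (chart_v phi)],
      [/\ {in chart_dom phi, continuous phi2},
          {in chart_dom phi &, injective phi2} &
          forall O : set (R * R), open O -> O `<=` chart_dom phi ->
            open (phi2 @` O)],
      smooth_on (chart_dom phi) (in_chart f phi) &
      forall u v, chart_dom phi (u, v) -> regular_at (in_chart f phi) u v].

(* A connected surface M immersed in R^3 by f, with atlas A.  The changes of
   charts are smooth because f is an immersion in every chart of A. *)
Definition immersed_surface f A : Prop :=
  [/\ hausdorff_space M, connected [set: M],
      forall phi, A phi -> immersive_chart f phi &
      forall m, exists2 phi, A phi & chart_image phi m].

(* H does not depend on the chart, up to sign.  Points where the induced metric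
   degenerates are allowed; H is required to vanish wherever it is defined. *)
Definition zero_mean_curvature f A : Prop :=
  forall phi u v, A phi -> chart_dom phi (u, v) ->
    ~ degenerate (tangent (in_chart f phi) u v) ->
    mean_curvature (in_chart f phi) u v = 0.

(* A nontrivial one-parameter group of linear isometries, acting on row vectors
   on the right and fixing the line directed by d pointwise. *)
Definition rotation_group (d : 'rV[R]_3) (G : R -> 'M[R]_3) : Prop :=
  [/\ forall s t, G (s + t) = G s *m G t,
      forall t, derivable G t 1,
      exists t, G t != 1%:M,
      forall t, lorentz_isometry (G t) &
      forall t, d *m G t = d].

(* The surface is locally invariant under the rotations about an axis p + R d.
   Local invariance makes open pieces of surfaces of revolution rotational. *)
Definition rotational f : Prop :=
  exists p d G, [/\ d != 0, rotation_group d G &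
    forall m (W : set M), nbhs m W ->
      \forall t \near (0 : R), (f @` W) (p + (f m - p) *m G t)].

(* The leaves are the u = constant curves of suitable charts; rad m is the
   radius of the circle containing the leaf through m.  All the planes are
   orthogonal to nu. *)
Definition foliated_by_circles f A (nu : 'rV[R]_3) (rad : M -> R) : Prop :=
  forall m, exists phi, [/\ A phi, chart_image phi m &
    forall u, chart_u phi u -> exists c rho, 0 < rho /\
      forall v, chart_v phi v ->
        circle nu c rho (in_chart f phi u v) /\ rad (chart_map phi u v) = rho].

Definition riemann_zmc_example f A (nu : 'rV[R]_3) (rad : M -> R) : Prop :=
  [/\ immersed_surface f A, ~ rotational f, zero_mean_curvature f A &
      foliated_by_circles f A nu rad].

End ImmersedSurfaces.

Section RiemannExamples.
Context {R : realType}.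

Definition riemannX (a : 'rV[R]_2) (r z v : R) : 'rV[R]_3 :=
  z *: vec3 (- r ^+ 2 * a 0 0) (- r ^+ 2 * a 0 1) 1
  + r *: vec3 (cos v) (sin v) 0.

(* X is a regular surface that is timelike away from the two disjoint lightlike
   straight lines L1 and L2, across which it extends smoothly. *)
Definition timelike_extended_to_lines (X : R -> R -> 'rV[R]_3)
    (L1 L2 : set 'rV[R]_3) : Prop :=
  [/\ lightlike_line L1, lightlike_line L2, L1 `&` L2 = set0 &
      [/\ smooth_on setT X, (forall z v, regular_at X z v),
          L1 `|` L2 `<=` [set X q.1 q.2 | q in setT] &
          forall z v,
            ((L1 `|` L2) (X z v) -> degenerate (tangent X z v)) /\
            (~ (L1 `|` L2) (X z v) -> timelike (tangent X z v))]].

End RiemannExamples.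

(* Main.v *)
Require Import Defs.
From HB Require Import structures.
From mathcomp Require Import all_boot all_order all_algebra.
From mathcomp Require Import all_classical all_reals all_analysis.
From mathcomp Require Import ring lra.
Import Order.TTheory GRing.Theory Num.Theory numFieldNormedType.Exports.
Local Open Scope classical_set_scope.
Local Open Scope ring_scope.
Set Implicit Arguments.
Unset Strict Implicit.
Unset Printing Implicit Defensive.

(* A Lorentz reflection makes the planes horizontal.  A foliated patch is then
   X = (c(u) + y(u, v), h(u)) with |y| = r, and the centre c is smooth because
   it is determined by the curvature of the arcs.  With primes denoting
   derivatives in u, the equation H = 0 reads
     y . (h' c'' - h'' c') = h' (|c'|^2 - h'^2),
   while EG - F^2 is a positive multiple of (y . c')^2 - r^2 h'^2.  As y runs
   over an arc, h' <> 0 forces |c'| = |h'| and c'/h' = e constant, so the patch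
   lies on the cylinder |(x_1, x_2) - d - x_3 e| = r with |e| = 1; and if h' = 0
   at a leaf then EG - F^2 > 0 there, which persists and makes the patch
   horizontal.  Planes and such cylinders are determined by any open piece, so
   the connected surface lies in a single one of them; a planar surface is
   rotational, so only the cylinders remain.  The tangent plane of the cylinder
   at radius vector y is degenerate exactly when y is parallel to e.
   Conversely the generator of a one-parameter group of isometries preserving
   the cylinder locally vanishes. *)

(** * Algebra of the Lorentz form *)

(** Two hypotheses are weaker than they look. The equation H = 0 is available only off the points
    where the metric degenerates, and a priori a whole leaf could be degenerate; the arc argument
    has to exclude that too. The centres of the circles are given leaf by leaf, without regularity,
    so they are differentiated through a formula in the derivatives of the immersion. The reflection
    is never composed with the charts: partial derivatives are multiplied by its matrix, which
    preserves EG - F^2 and scales the numerator of H by a constant. A piece inside a cylinder is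
    handled through its tangent planes alone: by regularity each is the kernel of the differential
    of the cylinder's equation, and this one fact yields the uniqueness of the cylinder, the
    exclusion of planes and the causal character. For a planar surface to be rotational, rotated
    points must lie in the image of an arbitrarily small neighbourhood, so the immersion must be
    shown open into its plane. The parameter of the family enters through e = - r^2 a, so |e| = 1
    reads r^2 |a| = 1. *)

Section Algebra.
Context {R : realType}.
Implicit Types (x y z : 'rV[R]_3).

Lemma vec3E (a b c : R) :
  (vec3 a b c 0 0 = a) * (vec3 a b c 0 1 = b) * (vec3 a b c 0 2 = c).
Proof. by rewrite /vec3 !mxE /=. Qed.

Lemma ord3P (i : 'I_3) : [\/ i = 0, i = 1 | i = 2].
Proof.
case: i => -[|[|[|//]]] h; [constructor 1|constructor 2|constructor 3];
  exact: val_inj.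
Qed.

Lemma row3P x y :
  x 0 0 = y 0 0 -> x 0 1 = y 0 1 -> x 0 2 = y 0 2 -> x = y.
Proof.
by move=> h0 h1 h2; apply/rowP => i; case: (ord3P i) => ->.
Qed.

Lemma mulmx3E m n (x : 'M[R]_(m, 3)) (B : 'M[R]_(3, n)) i j :
  (x *m B) i j = x i 0 * B 0 j + x i 1 * B 1 j + x i 2 * B 2 j.
Proof.
rewrite mxE !big_ord_recl big_ord0 addr0 addrA.
by congr (_ + _ * B _ _ + _ * B _ _); try congr (x _ _); exact: val_inj.
Qed.

Definition triple x y z : R := lorentz (lcross x y) z.

(** [triple] is the determinant, so this is its multiplicativity; the factor formed from the rows of
    [B] is the determinant of [B]. *)
Lemma triple_mul x y z (B : 'M[R]_3) :
  triple (x *m B) (y *m B) (z *m B) =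
  triple (row 0 B) (row 1 B) (row 2 B) * triple x y z.
Proof. by rewrite /triple /lorentz /lcross !vec3E !mulmx3E !mxE; ring. Qed.

Lemma lorentz_lcross x y :
  lorentz (lcross x y) (lcross x y) =
  lorentz x y ^+ 2 - lorentz x x * lorentz y y.
Proof. by rewrite /lorentz /lcross !vec3E; ring. Qed.

Lemma lorentzZl k x y : lorentz (k *: x) y = k * lorentz x y.
Proof. by rewrite /lorentz !mxE; ring. Qed.
Lemma lorentzZr k x y : lorentz x (k *: y) = k * lorentz x y.
Proof. by rewrite /lorentz !mxE; ring. Qed.
Lemma lorentzDl x y z : lorentz (x + y) z = lorentz x z + lorentz y z.
Proof. by rewrite /lorentz !mxE; ring. Qed.
Lemma lorentzDr x y z : lorentz x (y + z) = lorentz x y + lorentz x z.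
Proof. by rewrite /lorentz !mxE; ring. Qed.
Lemma lorentzC x y : lorentz x y = lorentz y x.
Proof. by rewrite /lorentz; ring. Qed.

Definition span2 x y : set 'rV[R]_3 :=
  [set a *: x + b *: y | a in setT & b in setT].

Lemma gram_nondegenerate x y :
  lorentz x x * lorentz y y - lorentz x y ^+ 2 != 0 ->
  ~ degenerate (span2 x y).
Proof.
move=> nd [_ [[a _ [b _ <-]] nz orth]].
have h1 : a * lorentz x x + b * lorentz x y = 0.
  rewrite -[RHS](orth x); last by exists 1 => //; exists 0 => //; rewrite scale1r scale0r addr0.
  by rewrite lorentzDl !lorentzZl (lorentzC y x).
have h2 : a * lorentz x y + b * lorentz y y = 0.
  rewrite -[RHS](orth y); last by exists 0 => //; exists 1 => //; rewrite scale1r scale0r add0r.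
  by rewrite lorentzDl !lorentzZl.
have ha : a * (lorentz x x * lorentz y y - lorentz x y ^+ 2) = 0.
  transitivity ((a * lorentz x x + b * lorentz x y) * lorentz y y
    - (a * lorentz x y + b * lorentz y y) * lorentz x y); first by ring.
  by rewrite h1 h2 !mul0r subrr.
have hb : b * (lorentz x x * lorentz y y - lorentz x y ^+ 2) = 0.
  transitivity ((a * lorentz x y + b * lorentz y y) * lorentz x x
    - (a * lorentz x x + b * lorentz x y) * lorentz x y); first by ring.
  by rewrite h1 h2 !mul0r subrr.
move/eqP: ha; rewrite mulf_eq0 (negbTE nd) orbF => /eqP ha.
move/eqP: hb; rewrite mulf_eq0 (negbTE nd) orbF => /eqP hb.
by move: nz; rewrite ha hb !scale0r addr0 eqxx.
Qed.

(** The kernel of a nonzero covector has rank 2, the rank of the free pair, so the inclusion of the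
    span in it is an equality. Tangent planes are identified in this way from a single equation. *)
Lemma span2_kernel x y (n : 'cV[R]_3) :
  row_free (col_mx x y) -> n != 0 -> x *m n = 0 -> y *m n = 0 ->
  forall t, t *m n = 0 -> span2 x y t.
Proof.
move=> fr n0 xn yn t tn.
have sub : (col_mx x y <= kermx n)%MS.
  by apply/sub_kermxP; rewrite mul_col_mx xn yn col_mx0.
have rk : \rank (kermx n) = 2%N.
  rewrite mxrank_ker.
  have : (0 < \rank n)%N by rewrite lt0n mxrank_eq0.
  by have := rank_leq_col n; case: (\rank n) => [|[|]].
have : (kermx n <= col_mx x y)%MS.
  by rewrite -(mxrank_leqif_sup sub) rk (eqP fr).
move=> sup; have /submxP[D ->] : (t <= col_mx x y)%MS.
  by apply: submx_trans sup; apply/sub_kermxP.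
exists (D 0 0) => //; exists (D 0 1) => //.
rewrite -[D in RHS]hsubmxK [lsubmx D]mx11_scalar [rsubmx D]mx11_scalar.
rewrite mul_row_col !mul_scalar_mx !mxE.
by congr (D _ _ *: _ + D _ _ *: _); exact: val_inj.
Qed.

Lemma row_free_pair x y : row_free (col_mx x y) ->
  forall a b, a *: x + b *: y = 0 -> a = 0 /\ b = 0.
Proof.
move=> fr a b ab.
have : row_mx a%:M b%:M *m col_mx x y = 0 *m col_mx x y :> 'rV_3.
  by rewrite mul_row_col !mul_scalar_mx mul0mx.
move=> /(row_free_inj fr) => /rowP e.
have := e (lshift 1 0); rewrite row_mxEl !mxE eqxx mulr1n => ->.
by have := e (rshift 1 0); rewrite row_mxEr !mxE eqxx mulr1n => ->.
Qed.

Lemma pair_row_free x y :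
  (forall a b, a *: x + b *: y = 0 -> a = 0 /\ b = 0) -> row_free (col_mx x y).
Proof.
move=> h; rewrite -kermx_eq0; apply/eqP/row_matrixP => i; rewrite row0.
set k := row i _.
have : k *m col_mx x y = 0 by apply/sub_kermxP; exact: row_sub.
rewrite -[k]hsubmxK mul_row_col [lsubmx k]mx11_scalar [rsubmx k]mx11_scalar.
by rewrite !mul_scalar_mx => /h[-> ->]; rewrite !raddf0 row_mx0.
Qed.

End Algebra.

(** * Mean curvature *)

Section MeanCurvature.
Context {R : realType}.
Implicit Types (x y : 'rV[R]_3).

Definition gram x y : R := lorentz x x * lorentz y y - lorentz x y ^+ 2.

(* The numerator of the mean curvature, for the unnormalized normal. *)
Definition mc_form (xu xv xuu xuv xvv : 'rV[R]_3) : R :=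
  triple xu xv xuu * lorentz xv xv - 2 * triple xu xv xuv * lorentz xu xv
  + triple xu xv xvv * lorentz xu xu.

Lemma gram_mul (B : 'M[R]_3) x y : lorentz_isometry B ->
  gram (x *m B) (y *m B) = gram x y.
Proof. by move=> isoB; rewrite /gram !isoB. Qed.

Lemma mc_form_mul (B : 'M[R]_3) xu xv xuu xuv xvv : lorentz_isometry B ->
  mc_form (xu *m B) (xv *m B) (xuu *m B) (xuv *m B) (xvv *m B)
  = triple (row 0 B) (row 1 B) (row 2 B) * mc_form xu xv xuu xuv xvv.
Proof. by move=> isoB; rewrite /mc_form !triple_mul !isoB; ring. Qed.

(** With N = k n for the unnormalized normal n, the factor <N, N> = - k^2 (EG - F^2) cancels the
    denominator, and H is - k^3 / 2 times [mc_form]. *)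
Lemma mean_curvature_eq0 (X : R -> R -> 'rV[R]_3) u v :
  gram (du X u v) (dv X u v) != 0 ->
  mean_curvature X u v = 0 <->
  mc_form (du X u v) (dv X u v) (du (du X) u v) (du (dv X) u v)
    (dv (dv X) u v) = 0.
Proof.
move=> nd; rewrite /mean_curvature /unit_normal /=.
move: (du X u v) (dv X u v) (du (du X) u v) (du (dv X) u v) (dv (dv X) u v) nd.
move=> xu xv xuu xuv xvv nd; set n := lcross _ _; set k := (Num.sqrt _)^-1.
have nn : lorentz n n = - gram xu xv.
  by rewrite lorentz_lcross /gram opprB.
have k0 : k != 0.
  rewrite invr_eq0 sqrtr_eq0 -ltNge normr_gt0 nn oppr_eq0 //.
rewrite !lorentzZl lorentzZr nn /mc_form /triple -/n.
rewrite -/(gram xu xv); set g := gram xu xv in nd *.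
set num := (X in _ <-> X = 0).
have -> : k * (k * - g) *
  ((k * lorentz n xuu * lorentz xv xv -
     2 * (k * lorentz n xuv) * lorentz xu xv +
     k * lorentz n xvv * lorentz xu xu) / (2 * g))
  = - (k ^+ 3 / 2) * num.
  by rewrite /num; field; rewrite nd.
split=> [/eqP|->]; last by rewrite mulr0.
rewrite mulf_eq0 oppr_eq0 mulf_eq0 invr_eq0 pnatr_eq0 expf_eq0 /= (negbTE k0).
by move=> /eqP.
Qed.

(* Where the metric degenerates, [mean_curvature] is a division by zero, hence 0. *)
Lemma mc_form_mean_curvature (X : R -> R -> 'rV[R]_3) u v :
  mc_form (du X u v) (dv X u v) (du (du X) u v) (du (dv X) u v)
    (dv (dv X) u v) = 0 -> mean_curvature X u v = 0.
Proof.
have [g0 _|nd] := eqVneq (gram (du X u v) (dv X u v)) 0; last first.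
  by move=> H; apply/(mean_curvature_eq0 nd).
rewrite /mean_curvature /= -/(gram (du X u v) (dv X u v)) g0.
by rewrite mulr0 invr0 !mulr0.
Qed.

(* The mean curvature of a surface foliated by circles of radius r: c1, c2, h
   are the derivatives of centre and height (with second derivatives d1, d2, k)
   and y is the radius vector at the point. *)
Section CircleIdentities.
Variables (r h k c1 c2 d1 d2 y1 y2 : R) (xu xv xuu xuv xvv : 'rV[R]_3).
Hypotheses (r0 : r != 0) (yy : y1 ^+ 2 + y2 ^+ 2 = r ^+ 2).
Hypotheses (hu : xu 0 2 = h) (hv : xv 0 2 = 0) (huu : xuu 0 2 = k)
  (huv : xuv 0 2 = 0) (hvv : xvv 0 2 = 0).
Hypothesis yu : y1 * (xu 0 0 - c1) + y2 * (xu 0 1 - c2) = 0.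
Hypothesis yv : y1 * xv 0 0 + y2 * xv 0 1 = 0.
Hypothesis yuu : y1 * (xuu 0 0 - d1) + y2 * (xuu 0 1 - d2)
  = - ((xu 0 0 - c1) ^+ 2 + (xu 0 1 - c2) ^+ 2).
Hypothesis yuv : y1 * xuv 0 0 + y2 * xuv 0 1
  = - ((xu 0 0 - c1) * xv 0 0 + (xu 0 1 - c2) * xv 0 1).
Hypothesis yvv : y1 * xvv 0 0 + y2 * xvv 0 1 = - (xv 0 0 ^+ 2 + xv 0 1 ^+ 2).

Let tangential a b : y1 * a + y2 * b = 0 ->
  exists t, a = - t * y2 /\ b = t * y1.
Proof.
move=> h0; exists ((y1 * b - y2 * a) / r ^+ 2).
have r2 : r ^+ 2 != 0 by rewrite expf_neq0.
split; apply: (mulIf r2).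
  transitivity ((y1 ^+ 2 + y2 ^+ 2) * a); first by rewrite yy mulrC.
  transitivity (y1 * (y1 * a + y2 * b) + - (y1 * b - y2 * a) * y2); first by ring.
  by rewrite h0; field.
transitivity ((y1 ^+ 2 + y2 ^+ 2) * b); first by rewrite yy mulrC.
transitivity (y2 * (y1 * a + y2 * b) + (y1 * b - y2 * a) * y1); first by ring.
by rewrite h0; field.
Qed.

Lemma circle_gram :
  r ^+ 2 * gram xu xv = (xv 0 0 ^+ 2 + xv 0 1 ^+ 2) *
    ((y1 * c1 + y2 * c2) ^+ 2 - r ^+ 2 * h ^+ 2).
Proof.
have [s [/eqP]] := tangential yu; rewrite subr_eq => /eqP s1 /eqP.
rewrite subr_eq => /eqP s2; have [t [t1 t2]] := tangential yv.
by rewrite /gram /lorentz hu hv s1 s2 t1 t2 -yy; ring.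
Qed.

(** The triple product with [xu] and [xv] sees a vector only through its product with y and its
    third coordinate, and for the second derivatives both are known from |y| = r. The angular
    velocity s of y in u cancels; the one in v, called t, survives only in the nonzero factor - t^3
    r^2. *)
Lemma circle_mc_form : (xv 0 0 != 0) || (xv 0 1 != 0) ->
  mc_form xu xv xuu xuv xvv = 0 ->
  y1 * (h * d1 - k * c1) + y2 * (h * d2 - k * c2)
  = h * (c1 ^+ 2 + c2 ^+ 2 - h ^+ 2).
Proof.
move=> xv0.
have [s [/eqP]] := tangential yu; rewrite subr_eq => /eqP s1 /eqP.
rewrite subr_eq => /eqP s2; have [t [t1 t2]] := tangential yv.
have t0 : t != 0.
  by apply: contraTneq xv0 => t0; rewrite t1 t2 t0 oppr0 !mul0r eqxx.
have e1 : y1 * xuu 0 0 + y2 * xuu 0 1 = y1 * d1 + y2 * d2 - s ^+ 2 * r ^+ 2.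
  transitivity (y1 * (xuu 0 0 - d1) + y2 * (xuu 0 1 - d2) + (y1 * d1 + y2 * d2)).
    by ring.
  by rewrite yuu s1 s2 -yy; ring.
have e2 : y1 * xuv 0 0 + y2 * xuv 0 1 = - (s * t * r ^+ 2).
  by rewrite yuv s1 s2 t1 t2 -yy; ring.
have e3 : y1 * xvv 0 0 + y2 * xvv 0 1 = - (t ^+ 2 * r ^+ 2).
  by rewrite yvv t1 t2 -yy; ring.
set g := y1 * c1 + y2 * c2.
have tr z : triple xu xv z = - t * (h * (y1 * z 0 0 + y2 * z 0 1) - g * z 0 2).
  rewrite /triple /lorentz /lcross !vec3E hu hv s1 s2 t1 t2 /g; ring.
rewrite /mc_form !tr e1 e2 e3 huu huv hvv /lorentz hu hv s1 s2 t1 t2 => eq0.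
have : - t ^+ 3 * r ^+ 2 * (y1 * (h * d1 - k * c1) + y2 * (h * d2 - k * c2)
  - h * (c1 ^+ 2 + c2 ^+ 2 - h ^+ 2)) = 0.
  by rewrite -[RHS]eq0 /g -yy; ring.
move/eqP; rewrite !mulf_eq0 oppr_eq0 !expf_eq0 /= (negbTE t0) (negbTE r0) /=.
by rewrite subr_eq0 => /eqP.
Qed.

End CircleIdentities.
End MeanCurvature.

(** * Derivatives of scalar functions and jets of surfaces *)

Section Calculus.
Context {R : realType}.
Implicit Types (f g : R -> R) (x a b : R) (I J : set R).

Lemma is_deriveDf x f g a b : is_derive x 1 f a -> is_derive x 1 g b ->
  is_derive x 1 (fun t => f t + g t) (a + b).
Proof. by move=> df dg; exact: is_deriveD. Qed.

Lemma is_deriveBf x f g a b : is_derive x 1 f a -> is_derive x 1 g b ->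
  is_derive x 1 (fun t => f t - g t) (a - b).
Proof. by move=> df dg; exact: is_deriveB. Qed.

Lemma is_deriveMf x f g a b : is_derive x 1 f a -> is_derive x 1 g b ->
  is_derive x 1 (fun t => f t * g t) (f x * b + g x * a).
Proof. by move=> df dg; exact: is_deriveM. Qed.

Lemma is_deriveVf x f a : f x != 0 -> is_derive x 1 f a ->
  is_derive x 1 (fun t => (f t)^-1) (- a / f x ^+ 2).
Proof.
move=> fx0 df; have dv : derivable f x 1 by case: df.
apply: DeriveDef; first exact: derivableV.
by rewrite deriveV // derive_val /GRing.scale /= mulrC mulNr mulrN.
Qed.

Lemma is_derive_continuous x f a : is_derive x 1 f a -> {for x, continuous f}.
Proof. by case=> /derivable1_diffP /differentiable_continuous. Qed.

Lemma is_derive_unique x f a b :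
  is_derive x 1 f a -> is_derive x 1 f b -> a = b.
Proof. by move=> [_ <-] [_ <-]. Qed.

(** Source of all differentiated identities: the derivation rules give the derivative explicitly,
    and the function is constant near the point. *)
Lemma is_derive_near_cst x f a b :
  is_derive x 1 f a -> (\forall y \near x, f y = b) -> a = 0.
Proof.
move=> df nf; apply: is_derive_unique df _.
apply: (near_eq_is_derive (f := cst b)).
by near=> y; apply/esym; near: y.
Unshelve. all: by end_near. Qed.

Lemma near_open (I : set R) x : open I -> I x -> \forall y \near x, I y.
Proof. by move=> oI Ix; apply: open_nbhs_nbhs; split. Qed.

Lemma is_derive0_itv f a b : (forall y, a < y < b -> is_derive y 1 f 0) ->
  forall y z, a < y < b -> a < z < b -> f y = f z.
Proof.
move=> df y z; wlog yz : y z / y <= z => [hw|] yab zab.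
  by case/orP: (le_total y z) => [yz|zy]; [|symmetry]; exact: hw.
have sub t : t \in `[y, z] -> a < t < b.
  rewrite in_itv /= => /andP[yt tz].
  by rewrite (lt_le_trans _ yt) ?(le_lt_trans tz) //; case/andP: yab; case/andP: zab.
have [||c _] := @MVT_segment R f (fun=> 0) y z yz.
- move=> t tyz; apply: df; apply: sub.
  by move: tyz; rewrite !in_itv /= => /andP[/ltW-> /ltW->].
- apply: continuous_in_subspaceT => u /set_mem /= uyz.
  by have /is_derive_continuous := df u (sub _ uyz).
by rewrite mul0r => /eqP; rewrite subr_eq0 => /eqP.
Qed.

(** The derivatives are existential and the second one need not be continuous, so closure under the
    operations follows from the pointwise rules. *)
Definition twice_diff I f := exists f1 f2 : R -> R, forall u, I u ->
  is_derive u 1 f (f1 u) /\ is_derive u 1 f1 (f2 u).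

Lemma twice_diff_eq I f g : open I -> (forall u, I u -> g u = f u) ->
  twice_diff I f -> twice_diff I g.
Proof.
move=> oI fg [f1 [f2 df]]; exists f1, f2 => u Iu; have [d1 d2] := df u Iu.
split=> //; apply: near_eq_is_derive d1.
by near=> y; rewrite fg //; near: y; exact: near_open.
Unshelve. all: by end_near. Qed.

Lemma twice_diffB I f g :
  twice_diff I f -> twice_diff I g -> twice_diff I (fun u => f u - g u).
Proof.
move=> [f1 [f2 df]] [g1 [g2 dg]].
exists (fun u => f1 u - g1 u), (fun u => f2 u - g2 u) => u Iu.
by have [? ?] := df u Iu; have [? ?] := dg u Iu; split; exact: is_deriveBf.
Qed.

Lemma twice_diffD I f g :
  twice_diff I f -> twice_diff I g -> twice_diff I (fun u => f u + g u).
Proof.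
move=> [f1 [f2 df]] [g1 [g2 dg]].
exists (fun u => f1 u + g1 u), (fun u => f2 u + g2 u) => u Iu.
by have [? ?] := df u Iu; have [? ?] := dg u Iu; split; exact: is_deriveDf.
Qed.

Lemma twice_diffM I f g :
  twice_diff I f -> twice_diff I g -> twice_diff I (fun u => f u * g u).
Proof.
move=> [f1 [f2 df]] [g1 [g2 dg]].
exists (fun u => f u * g1 u + g u * f1 u).
eexists => u Iu; have [? ?] := df u Iu; have [? ?] := dg u Iu.
split; first exact: is_deriveMf.
by apply: is_deriveDf; exact: is_deriveMf.
Qed.

Lemma twice_diffV I f : (forall u, I u -> f u != 0) ->
  twice_diff I f -> twice_diff I (fun u => (f u)^-1).
Proof.
move=> f0 [f1 [f2 df]].
exists (fun u => (0 - f1 u) * (f u * f u)^-1).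
eexists => u Iu; have [d1 d2] := df u Iu.
split.
  by have := is_deriveVf (f0 _ Iu) d1; rewrite sub0r expr2.
apply: (is_deriveMf (is_deriveBf (is_derive_cst 0 u 1) d2)).
apply: (is_deriveVf (f := fun u => f u * f u)); first by rewrite mulf_neq0 ?f0.
Qed.

End Calculus.

Section Jets.
Context {R : realType}.
Implicit Types (I J : set R) (X : R -> R -> 'rV[R]_3).

(* A family indexed by words, closed under partial derivatives as in [partial]. *)
Definition jet_on I J (P : seq bool -> R -> R -> 'rV[R]_3) : Prop :=
  forall w i u v, I u -> J v ->
    is_derive u 1 (fun s => P w s v 0 i) (P (true :: w) u v 0 i) /\
    is_derive v 1 (fun s => P w u s 0 i) (P (false :: w) u v 0 i).

Lemma is_derive_coord (f : R -> 'rV[R]_3) x i :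
  derivable f x 1 -> is_derive x 1 (fun s => f s 0 i) (derive1 f x 0 i).
Proof.
move=> df; rewrite derive1E derive_mx // mxE; apply: derivableP.
by move/derivable_mxP : df; exact.
Qed.

Lemma smooth_jet I J X :
  smooth_on (I `*` J) X -> jet_on I J (fun w u v => partial w X u v).
Proof.
move=> sX w i u v Iu Jv; have [_ du dv] := sX w (u, v) (conj Iu Jv).
by split; [exact: (is_derive_coord _ du)|exact: (is_derive_coord _ dv)].
Qed.

(** Brings the planes into horizontal position at the level of derivatives, the immersion itself
    being left alone. *)
Lemma jet_mul I J P (B : 'M[R]_3) :
  jet_on I J P -> jet_on I J (fun w u v => P w u v *m B).
Proof.
move=> jP w i u v Iu Jv.
split; rewrite mulmx3E.
  rewrite (_ : (fun s => _) = fun s => P w s v 0 0 * B 0 i + P w s v 0 1 * B 1 i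
    + P w s v 0 2 * B 2 i); last by apply/funext => s; rewrite mulmx3E.
  have d j : is_derive u 1 (fun s => P w s v 0 j * B j i)
      (P (true :: w) u v 0 j * B j i).
    have [dj _] := jP w j u v Iu Jv.
    have := is_deriveMf dj (is_derive_cst (B j i) u 1).
    by rewrite mulr0 add0r mulrC.
  by do 2?apply: is_deriveDf; exact: d.
rewrite (_ : (fun s => _) = fun s => P w u s 0 0 * B 0 i + P w u s 0 1 * B 1 i
  + P w u s 0 2 * B 2 i); last by apply/funext => s; rewrite mulmx3E.
have d j : is_derive v 1 (fun s => P w u s 0 j * B j i)
    (P (false :: w) u v 0 j * B j i).
  have [_ dj] := jP w j u v Iu Jv.
  have := is_deriveMf dj (is_derive_cst (B j i) v 1).
  by rewrite mulr0 add0r mulrC.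
by do 2?apply: is_deriveDf; exact: d.
Qed.

End Jets.

(** * Local classification *)

Section Cylinders.
Context {R : realType}.

(* The affine cylinder with rulings directed by (b1, b2, 1) over the circle of
   centre (d1, d2) and radius r in the plane x_3 = 0. *)
Definition cylinder (r b1 b2 d1 d2 : R) : set 'rV[R]_3 :=
  [set x | (x 0 0 - d1 - x 0 2 * b1) ^+ 2 + (x 0 1 - d2 - x 0 2 * b2) ^+ 2
           = r ^+ 2].

End Cylinders.

Section CircleFoliation.
Context {R : realType}.
Variables (I J : set R) (P : seq bool -> R -> R -> 'rV[R]_3) (r : R)
  (c1 c2 h : R -> R).
Hypotheses (oI : open I) (oJ : open J) (jP : jet_on I J P) (r0 : 0 < r).
Hypothesis regP : forall u v, I u -> J v ->
  row_free (col_mx (P [:: true] u v) (P [:: false] u v)).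
Hypothesis zmcP : forall u v, I u -> J v ->
  gram (P [:: true] u v) (P [:: false] u v) != 0 ->
  mc_form (P [:: true] u v) (P [:: false] u v) (P [:: true; true] u v)
    (P [:: true; false] u v) (P [:: false; false] u v) = 0.
Hypothesis heightP : forall u v, I u -> J v -> P [::] u v 0 2 = h u.
Hypothesis circleP : forall u v, I u -> J v ->
  (P [::] u v 0 0 - c1 u) ^+ 2 + (P [::] u v 0 1 - c2 u) ^+ 2 = r ^+ 2.

Let y1 u v := P [::] u v 0 0 - c1 u.
Let y2 u v := P [::] u v 0 1 - c2 u.

Let rn0 : r != 0. Proof. by rewrite gt_eqF. Qed.

Let isu w i u v (Iu : I u) (Jv : J v) := (jP w i Iu Jv).1.
Let isv w i u v (Iu : I u) (Jv : J v) := (jP w i Iu Jv).2.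

Let is_y1v u v : I u -> J v -> is_derive v 1 (y1 u) (P [:: false] u v 0 0).
Proof.
move=> Iu Jv; have := is_deriveBf (isv [::] 0 Iu Jv) (is_derive_cst (c1 u) v 1).
by rewrite subr0.
Qed.
Let is_y2v u v : I u -> J v -> is_derive v 1 (y2 u) (P [:: false] u v 0 1).
Proof.
move=> Iu Jv; have := is_deriveBf (isv [::] 1 Iu Jv) (is_derive_cst (c2 u) v 1).
by rewrite subr0.
Qed.

Let circ u v : I u -> J v -> y1 u v ^+ 2 + y2 u v ^+ 2 = r ^+ 2.
Proof. exact: circleP. Qed.

Lemma height_v u v : I u -> J v -> P [:: false] u v 0 2 = 0.
Proof.
move=> Iu Jv; apply: is_derive_near_cst (isv [::] 2 Iu Jv) _.
by near=> t; apply: heightP => //; near: t; exact: near_open.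
Unshelve. all: by end_near. Qed.

Lemma height_vv u v : I u -> J v -> P [:: false; false] u v 0 2 = 0.
Proof.
move=> Iu Jv; apply: is_derive_near_cst (isv [:: false] 2 Iu Jv) _.
by near=> t; apply: height_v => //; near: t; exact: near_open.
Unshelve. all: by end_near. Qed.

Lemma height_uv u v : I u -> J v -> P [:: true; false] u v 0 2 = 0.
Proof.
move=> Iu Jv; apply: is_derive_near_cst (isu [:: false] 2 Iu Jv) _.
by near=> t; apply: height_v => //; near: t; exact: near_open.
Unshelve. all: by end_near. Qed.

Lemma radius_v u v : I u -> J v ->
  y1 u v * P [:: false] u v 0 0 + y2 u v * P [:: false] u v 0 1 = 0.
Proof.
move=> Iu Jv.
have d1 := is_y1v Iu Jv; have d2 := is_y2v Iu Jv.
have := is_derive_near_cst (is_deriveDf (is_deriveMf d1 d1) (is_deriveMf d2 d2)).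
move=> /(_ (r ^+ 2)) H; have : (2 : R) != 0 by rewrite pnatr_eq0.
move/mulfI; apply; rewrite mulr0 -[RHS]H; first by ring.
near=> t; rewrite -!expr2; apply: circ => //; near: t; exact: near_open.
Unshelve. all: by end_near. Qed.

Lemma radius_vv u v : I u -> J v ->
  y1 u v * P [:: false; false] u v 0 0 + y2 u v * P [:: false; false] u v 0 1
  = - (P [:: false] u v 0 0 ^+ 2 + P [:: false] u v 0 1 ^+ 2).
Proof.
move=> Iu Jv.
have d1 := is_deriveMf (is_y1v Iu Jv) (isv [:: false] 0 Iu Jv).
have d2 := is_deriveMf (is_y2v Iu Jv) (isv [:: false] 1 Iu Jv).
have := is_derive_near_cst (is_deriveDf d1 d2).
move=> /(_ 0) H; apply/eqP; rewrite -subr_eq0 opprK; apply/eqP.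
rewrite -[RHS]H; first by ring.
by near=> t; apply: radius_v => //; near: t; exact: near_open.
Unshelve. all: by end_near. Qed.

Let S u v := P [:: false] u v 0 0 ^+ 2 + P [:: false] u v 0 1 ^+ 2.
Let D u v := P [:: false] u v 0 0 * P [:: false; false] u v 0 1
  - P [:: false] u v 0 1 * P [:: false; false] u v 0 0.

Lemma dv_neq0 u v : I u -> J v ->
  (P [:: false] u v 0 0 != 0) || (P [:: false] u v 0 1 != 0).
Proof.
move=> Iu Jv; rewrite -negb_and; apply/negP => /andP[/eqP z0 /eqP z1].
have [_ /eqP] : (0 : R) = 0 /\ (1 : R) = 0.
  apply: (row_free_pair (regP Iu Jv)); rewrite scale0r add0r scale1r.
  by apply: row3P; rewrite ?mxE // height_v.
by rewrite oner_eq0.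
Qed.

Lemma dv_sqr_neq0 u v : I u -> J v -> S u v != 0.
Proof.
move=> Iu Jv; have := dv_neq0 Iu Jv.
by rewrite -negb_and /S paddr_eq0 ?sqr_ge0 // !sqrf_eq0.
Qed.

(** With p the velocity of the arc, y . p = 0 and y . p' = - |p|^2 form a linear system for y,
    solved here by Cramer's rule. Its determinant [D] is the signed curvature of the arc times
    |p|^3. *)
Lemma det_radius u v : I u -> J v ->
  y1 u v * D u v = P [:: false] u v 0 1 * S u v /\
  y2 u v * D u v = - P [:: false] u v 0 0 * S u v.
Proof.
move=> Iu Jv; have e1 := radius_v Iu Jv; have e2 := radius_vv Iu Jv.
rewrite -/(S u v) in e2; rewrite /D.
move: (y1 u v) (y2 u v) (S u v) e1 e2 => a b s.
set p := P [:: false] u v 0 0; set q := P [:: false] u v 0 1.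
move: p q (P [:: false; false] u v 0 0) (P [:: false; false] u v 0 1).
move=> p q k l e1 e2; split.
  transitivity ((a * p + b * q) * l - q * (a * k + b * l)); first by ring.
  by rewrite e1 e2; ring.
transitivity (p * (a * k + b * l) - (a * p + b * q) * k); first by ring.
by rewrite e1 e2; ring.
Qed.

Lemma det_neq0 u v : I u -> J v -> D u v != 0.
Proof.
move=> Iu Jv; apply/negP => /eqP D0; have [] := det_radius Iu Jv.
rewrite D0 !mulr0 => /esym/eqP + /esym/eqP.
rewrite !mulf_eq0 (negbTE (dv_sqr_neq0 Iu Jv)) !orbF oppr_eq0 => h1 h2.
by have := dv_neq0 Iu Jv; rewrite h1 h2.
Qed.

Let td w i v : J v -> twice_diff I (fun u => P w u v 0 i).
Proof.
move=> Jv; exists (fun u => P (true :: w) u v 0 i).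
by exists (fun u => P [:: true, true & w] u v 0 i) => u Iu; split; exact: isu.
Qed.

(* The centre is determined by the curvature of the arc, hence it depends
   smoothly on the leaf. *)
Lemma twice_diff_centre v : J v -> twice_diff I c1 /\ twice_diff I c2.
Proof.
move=> Jv.
have tS : twice_diff I (S^~ v).
  by apply: twice_diffD; apply: twice_diffM; exact: td.
have tD : twice_diff I (fun u => (D u v)^-1).
  apply: twice_diffV; first by move=> u Iu; exact: det_neq0.
  by apply: twice_diffB; apply: twice_diffM; exact: td.
have tSD := twice_diffM tS tD.
have t1 := twice_diffB (td [::] 0 Jv) (twice_diffM (td [:: false] 1 Jv) tSD).
have t2 := twice_diffD (td [::] 1 Jv) (twice_diffM (td [:: false] 0 Jv) tSD).
split; [apply: twice_diff_eq oI _ t1|apply: twice_diff_eq oI _ t2] => u Iu /=.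
- have [e _] := det_radius Iu Jv.
  by rewrite mulrA -e mulfK ?det_neq0 // /y1; ring.
- have [_ e] := det_radius Iu Jv.
  rewrite mulrA -[P [:: false] u v 0 0 * S u v]opprK -mulNr -e.
  by rewrite mulNr mulfK ?det_neq0 // /y2; ring.
Qed.


(** * Consequences of H = 0 along one leaf and near it *)

Section Leaves.
Variables (a1 a2 b1 b2 k1 k2 : R -> R).
Hypothesis dc1 : forall u, I u -> is_derive u 1 c1 (a1 u) /\ is_derive u 1 a1 (b1 u).
Hypothesis dc2 : forall u, I u -> is_derive u 1 c2 (a2 u) /\ is_derive u 1 a2 (b2 u).
Hypothesis dh : forall u, I u -> is_derive u 1 h (k1 u) /\ is_derive u 1 k1 (k2 u).

Lemma height_u u v : I u -> J v -> P [:: true] u v 0 2 = k1 u.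
Proof.
move=> Iu Jv; have := is_derive_near_cst (is_deriveBf (isu [::] 2 Iu Jv) (dh Iu).1).
move=> /(_ 0) H; apply/eqP; rewrite -subr_eq0; apply/eqP/H.
by near=> t; rewrite heightP ?subrr //; near: t; exact: near_open.
Unshelve. all: by end_near. Qed.

Lemma height_uu u v : I u -> J v -> P [:: true; true] u v 0 2 = k2 u.
Proof.
move=> Iu Jv; have := is_derive_near_cst (is_deriveBf (isu [:: true] 2 Iu Jv) (dh Iu).2).
move=> /(_ 0) H; apply/eqP; rewrite -subr_eq0; apply/eqP/H.
by near=> t; rewrite height_u ?subrr //; near: t; exact: near_open.
Unshelve. all: by end_near. Qed.

Let is_y1u u v : I u -> J v ->
  is_derive u 1 (y1^~ v) (P [:: true] u v 0 0 - a1 u).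
Proof. by move=> Iu Jv; exact: is_deriveBf (isu [::] 0 Iu Jv) (dc1 Iu).1. Qed.
Let is_y2u u v : I u -> J v ->
  is_derive u 1 (y2^~ v) (P [:: true] u v 0 1 - a2 u).
Proof. by move=> Iu Jv; exact: is_deriveBf (isu [::] 1 Iu Jv) (dc2 Iu).1. Qed.

Lemma radius_u u v : I u -> J v ->
  y1 u v * (P [:: true] u v 0 0 - a1 u) + y2 u v * (P [:: true] u v 0 1 - a2 u) = 0.
Proof.
move=> Iu Jv.
have d1 := is_y1u Iu Jv; have d2 := is_y2u Iu Jv.
have := is_derive_near_cst (is_deriveDf (is_deriveMf d1 d1) (is_deriveMf d2 d2)).
move=> /(_ (r ^+ 2)) H; have : (2 : R) != 0 by rewrite pnatr_eq0.
move/mulfI; apply; rewrite mulr0 -[RHS]H; first by ring.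
near=> t; rewrite -!expr2; apply: circ => //; near: t; exact: near_open.
Unshelve. all: by end_near. Qed.

Lemma radius_uu u v : I u -> J v ->
  y1 u v * (P [:: true; true] u v 0 0 - b1 u)
    + y2 u v * (P [:: true; true] u v 0 1 - b2 u)
  = - ((P [:: true] u v 0 0 - a1 u) ^+ 2 + (P [:: true] u v 0 1 - a2 u) ^+ 2).
Proof.
move=> Iu Jv.
have d1 := is_deriveMf (is_y1u Iu Jv)
  (is_deriveBf (isu [:: true] 0 Iu Jv) (dc1 Iu).2).
have d2 := is_deriveMf (is_y2u Iu Jv)
  (is_deriveBf (isu [:: true] 1 Iu Jv) (dc2 Iu).2).
have := is_derive_near_cst (is_deriveDf d1 d2).
move=> /(_ 0) H; apply/eqP; rewrite -subr_eq0 opprK; apply/eqP.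
rewrite -[RHS]H; first by ring.
by near=> t; apply: radius_u => //; near: t; exact: near_open.
Unshelve. all: by end_near. Qed.

Lemma radius_uv u v : I u -> J v ->
  y1 u v * P [:: true; false] u v 0 0 + y2 u v * P [:: true; false] u v 0 1
  = - ((P [:: true] u v 0 0 - a1 u) * P [:: false] u v 0 0
       + (P [:: true] u v 0 1 - a2 u) * P [:: false] u v 0 1).
Proof.
move=> Iu Jv.
have d1 := is_deriveMf (is_y1u Iu Jv) (isu [:: false] 0 Iu Jv).
have d2 := is_deriveMf (is_y2u Iu Jv) (isu [:: false] 1 Iu Jv).
have := is_derive_near_cst (is_deriveDf d1 d2).
move=> /(_ 0) H; apply/eqP; rewrite -subr_eq0 opprK; apply/eqP.
rewrite -[RHS]H; first by ring.
by near=> t; apply: radius_v => //; near: t; exact: near_open.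
Unshelve. all: by end_near. Qed.

Let g u v := (y1 u v * a1 u + y2 u v * a2 u) ^+ 2 - r ^+ 2 * k1 u ^+ 2.

Lemma leaf_gram u v : I u -> J v ->
  r ^+ 2 * gram (P [:: true] u v) (P [:: false] u v) = S u v * g u v.
Proof.
move=> Iu Jv; exact: (circle_gram rn0 (circ Iu Jv) (height_u Iu Jv)
  (height_v Iu Jv) (radius_u Iu Jv) (radius_v Iu Jv)).
Qed.

Lemma leaf_zmc u v : I u -> J v -> g u v != 0 ->
  y1 u v * (k1 u * b1 u - k2 u * a1 u) + y2 u v * (k1 u * b2 u - k2 u * a2 u)
  = k1 u * (a1 u ^+ 2 + a2 u ^+ 2 - k1 u ^+ 2).
Proof.
move=> Iu Jv g0; apply: (circle_mc_form rn0 (circ Iu Jv) (height_u Iu Jv)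
  (height_v Iu Jv) (height_uu Iu Jv) (height_uv Iu Jv) (height_vv Iu Jv)
  (radius_u Iu Jv) (radius_v Iu Jv) (radius_uu Iu Jv) (radius_uv Iu Jv)
  (radius_vv Iu Jv) (dv_neq0 Iu Jv)).
apply: zmcP => //; apply: contraNneq g0 => g0.
have := leaf_gram Iu Jv; rewrite g0 mulr0 => /esym/eqP.
by rewrite mulf_eq0 (negbTE (dv_sqr_neq0 Iu Jv)).
Qed.

Let g_continuous u v : I u -> J v -> {for v, continuous (g u)}.
Proof.
move=> Iu Jv.
have e1 := is_deriveMf (is_y1v Iu Jv) (is_derive_cst (a1 u) v 1).
have e2 := is_deriveMf (is_y2v Iu Jv) (is_derive_cst (a2 u) v 1).
have e := is_deriveDf e1 e2.
have := is_deriveBf (is_deriveMf e e) (is_derive_cst (r ^+ 2 * k1 u ^+ 2) v 1).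
by move/is_derive_continuous.
Qed.

(** Differentiating once more, m is orthogonal to both velocity and acceleration of the arc, which
    are independent because [D] does not vanish. *)
Lemma arc_tangent_linear u v m1 m2 : I u -> J v ->
  (\forall t \near v,
    P [:: false] u t 0 0 * m1 + P [:: false] u t 0 1 * m2 = 0) ->
  m1 = 0 /\ m2 = 0.
Proof.
move=> Iu Jv h1.
have e1 := is_deriveMf (isv [:: false] 0 Iu Jv) (is_derive_cst m1 v 1).
have e2 := is_deriveMf (isv [:: false] 1 Iu Jv) (is_derive_cst m2 v 1).
have := is_derive_near_cst (is_deriveDf e1 e2) h1.
rewrite !mulr0 !add0r => h2; have {}h1 := nbhs_singleton h1.
have := det_neq0 Iu Jv; rewrite /D; move: h1 h2 => /=.
move: (P [:: false] u v 0 0) (P [:: false] u v 0 1) => p q.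
move: (P [:: false; false] u v 0 0) (P [:: false; false] u v 0 1) => k l.
move=> h1 h2 d0; split; apply: (mulIf d0); rewrite mul0r.
  transitivity (l * (p * m1 + q * m2) - q * (m1 * k + m2 * l)); first by ring.
  by rewrite h1 h2; ring.
transitivity (p * (m1 * k + m2 * l) - k * (p * m1 + q * m2)); first by ring.
by rewrite h1 h2; ring.
Qed.

Lemma arc_linear u v m1 m2 m : I u -> J v ->
  (\forall t \near v, y1 u t * m1 + y2 u t * m2 = m) -> m1 = 0 /\ m2 = 0.
Proof.
move=> Iu Jv H; apply: (arc_tangent_linear Iu Jv).
have : \forall t \near v, \forall s \near t, y1 u s * m1 + y2 u s * m2 = m.
  exact: near_join.
move=> H2; near=> t.
have Jt : J t by near: t; exact: near_open.
have e1 := is_deriveMf (is_y1v Iu Jt) (is_derive_cst m1 t 1).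
have e2 := is_deriveMf (is_y2v Iu Jt) (is_derive_cst m2 t 1).
have := is_derive_near_cst (is_deriveDf e1 e2).
move=> /(_ m) E; rewrite -[RHS]E; first by rewrite /=; ring.
by near: t.
Unshelve. all: by end_near. Qed.

(** Near a nondegenerate point of the leaf the identity given by H = 0 is affine in y along a
    subarc, so its linear coefficients vanish, and then its constant term. One such point suffices,
    as c and h depend on u alone. *)
Lemma leaf_equations u v : I u -> J v -> k1 u != 0 ->
  [/\ a1 u ^+ 2 + a2 u ^+ 2 = k1 u ^+ 2,
      k1 u * b1 u - k2 u * a1 u = 0 & k1 u * b2 u - k2 u * a2 u = 0].
Proof.
move=> Iu Jv k0.
have [[v1 [Jv1 g0]]|alldeg] := pselect (exists v1, J v1 /\ g u v1 != 0).
  have H : \forall t \near v1, y1 u t * (k1 u * b1 u - k2 u * a1 u)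
      + y2 u t * (k1 u * b2 u - k2 u * a2 u)
      = k1 u * (a1 u ^+ 2 + a2 u ^+ 2 - k1 u ^+ 2).
    near=> t; apply: leaf_zmc => //; near: t; first exact: near_open.
    exact: cvgr_neq0 (g_continuous Iu Jv1) g0.
  have [m1 m2] := arc_linear Iu Jv1 H; split=> //.
  have := nbhs_singleton H; rewrite m1 m2 !mulr0 addr0 => /esym/eqP.
  by rewrite mulf_eq0 (negbTE k0) /= subr_eq0 => /eqP.
have deg t : J t -> g u t = 0.
  by move=> Jt; apply: contrapT => g0; apply: alldeg; exists t; split => //; apply/eqP.
(* On a leaf that is degenerate throughout, (y . c')^2 = r^2 h'^2 is a nonzero constant. Then y . c'
   has zero derivative along the arc, which forces c' = 0 and contradicts that y . c' is nonzero. *)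
pose e t := y1 u t * a1 u + y2 u t * a2 u.
have e0 t : J t -> e t != 0.
  move=> /deg /eqP; rewrite subr_eq0 => /eqP et.
  by rewrite -sqrf_eq0 et mulf_neq0 ?sqrf_eq0.
have [|m1 m2] := @arc_tangent_linear u v (a1 u) (a2 u) Iu Jv; last first.
  by have := e0 v Jv; rewrite /e m1 m2 !mulr0 addr0 eqxx.
near=> t; have Jt : J t by near: t; exact: near_open.
have e1 := is_deriveMf (is_y1v Iu Jt) (is_derive_cst (a1 u) t 1).
have e2 := is_deriveMf (is_y2v Iu Jt) (is_derive_cst (a2 u) t 1).
have de := is_deriveDf e1 e2.
have := is_derive_near_cst (is_deriveMf de de).
move=> /(_ (r ^+ 2 * k1 u ^+ 2)) E.
have n2 : 2 * e t != 0 by rewrite mulf_neq0 ?pnatr_eq0 ?e0.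
apply: (mulfI n2); rewrite mulr0 -[RHS]E; first by rewrite /e /=; ring.
near=> s; apply/eqP; rewrite -subr_eq0 -expr2; apply/eqP/deg; near: s.
exact: near_open.
Unshelve. all: by end_near. Qed.


Lemma steep_leaves u0 v0 : I u0 -> J v0 -> k1 u0 != 0 ->
  exists e1 e2 d1 d2, e1 ^+ 2 + e2 ^+ 2 = 1 /\
    \forall u \near u0, c1 u - h u * e1 = d1 /\ c2 u - h u * e2 = d2.
Proof.
move=> Iu0 Jv0 k0.
have : \forall u \near u0, I u /\ k1 u != 0.
  near=> u; split; near: u; first exact: near_open.
  exact: cvgr_neq0 (is_derive_continuous (dh Iu0).2) k0.
case=> e /= e0 sub.
have {}sub u : u0 - e < u < u0 + e -> I u /\ k1 u != 0.
  by move=> ue; apply: sub; rewrite /ball /= distrC ltr_distl.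
have mid : u0 - e < u0 < u0 + e by rewrite ltrBlDr ltrDl e0.
have slope (a b : R -> R) : (forall u, I u -> is_derive u 1 a (b u)) ->
    (forall u, I u -> k1 u != 0 -> k1 u * b u - k2 u * a u = 0) ->
    forall u, u0 - e < u < u0 + e -> a u / k1 u = a u0 / k1 u0.
  move=> da E u ue.
  apply: (@is_derive0_itv _ (fun t => a t / k1 t) (u0 - e) (u0 + e)) => //.
  move=> {}u {ue} /sub[Iu ku].
  have := is_deriveMf (da u Iu) (is_deriveVf ku (dh Iu).2).
  congr is_derive; transitivity ((k1 u * b u - k2 u * a u) / k1 u ^+ 2).
    by field.
  by rewrite E // mul0r.
have s1 : forall u, u0 - e < u < u0 + e -> a1 u / k1 u = a1 u0 / k1 u0.
  apply: (slope a1 b1); first by move=> u /dc1[].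
  by move=> u Iu ku; have [] := leaf_equations Iu Jv0 ku.
have s2 : forall u, u0 - e < u < u0 + e -> a2 u / k1 u = a2 u0 / k1 u0.
  apply: (slope a2 b2); first by move=> u /dc2[].
  by move=> u Iu ku; have [] := leaf_equations Iu Jv0 ku.
exists (a1 u0 / k1 u0), (a2 u0 / k1 u0).
exists (c1 u0 - h u0 * (a1 u0 / k1 u0)), (c2 u0 - h u0 * (a2 u0 / k1 u0)); split.
  have [E _ _] := leaf_equations Iu0 Jv0 k0.
  by rewrite !exprMn -mulrDl E exprVn mulfV ?sqrf_eq0.
have centre (c a : R -> R) : (forall u, I u -> is_derive u 1 c (a u)) ->
    (forall u, u0 - e < u < u0 + e -> a u / k1 u = a u0 / k1 u0) ->
    forall u, u0 - e < u < u0 + e ->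
    c u - h u * (a u0 / k1 u0) = c u0 - h u0 * (a u0 / k1 u0).
  move=> dc E u ue.
  apply: (@is_derive0_itv _ (fun t => c t - h t * (a u0 / k1 u0))
    (u0 - e) (u0 + e)) => //.
  move=> {}u {}ue; have [Iu ku] := sub u ue.
  have := is_deriveBf (dc u Iu)
    (is_deriveMf (dh Iu).1 (is_derive_cst (a u0 / k1 u0) u 1)).
  by congr is_derive; rewrite mulr0 add0r /= -(E u ue) divfK // subrr.
near=> u; have ue : u0 - e < u < u0 + e.
  by rewrite -ltr_distl; near: u; exists e => //= y; rewrite /ball /= distrC.
split; first by apply: (centre c1 a1) ue => // t /dc1[].
by apply: (centre c2 a2) ue => // t /dc2[].
Unshelve. all: by end_near. Qed.

(** If y . c' were 0 where h' = 0, both partial derivatives would be horizontal and orthogonal to y,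
    hence parallel, against regularity. *)
Lemma flat_transverse u0 v0 : I u0 -> J v0 -> k1 u0 = 0 ->
  y1 u0 v0 * a1 u0 + y2 u0 v0 * a2 u0 != 0.
Proof.
move=> Iu0 Jv0 k0; apply/negP => /eqP ya.
have := radius_u Iu0 Jv0; have := radius_v Iu0 Jv0.
have := dv_neq0 Iu0 Jv0; have := circ Iu0 Jv0.
have := row_free_pair (regP Iu0 Jv0).
have := height_u Iu0 Jv0; have := height_v Iu0 Jv0; rewrite k0.
move: (P [:: true] u0 v0) (P [:: false] u0 v0) => x y z1 z2 free.
move: (y1 u0 v0) (y2 u0 v0) ya => s t ya circ0 nz e1 e2.
have det0 : x 0 0 * y 0 1 - x 0 1 * y 0 0 = 0.
  have st : s ^+ 2 + t ^+ 2 != 0 by rewrite circ0 sqrf_eq0.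
  have e3 : s * x 0 0 + t * x 0 1 = 0.
    by rewrite -[RHS]addr0 -{1}e2 -[RHS]addr0 -{1}ya; ring.
  apply: (mulIf st); rewrite mul0r.
  transitivity ((s * x 0 0 + t * x 0 1) * (s * y 0 1 - t * y 0 0)
    - (s * y 0 0 + t * y 0 1) * (s * x 0 1 - t * x 0 0)); first by ring.
  by rewrite e3 e1; ring.
have [] : y 0 0 = 0 /\ - x 0 0 = 0.
  apply: free; apply: row3P; rewrite !mxE ?z1 ?z2; first by ring.
    by rewrite -[RHS]oppr0 -det0; ring.
  by ring.
have [] : y 0 1 = 0 /\ - x 0 1 = 0.
  apply: free; apply: row3P; rewrite !mxE ?z1 ?z2; last by ring.
    by rewrite -[RHS]det0; ring.
  by ring.
by move=> h1 _ h2; move: nz; rewrite h1 h2 eqxx.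
Qed.

Lemma flat_leaves u0 v0 : I u0 -> J v0 -> k1 u0 = 0 ->
  \forall u \near u0, h u = h u0.
Proof.
move=> Iu0 Jv0 k0.
have g0 : 0 < g u0 v0.
  by rewrite /g k0 expr0n mulr0 subr0 exprn_even_gt0 //= flat_transverse.
have cg : {for u0, continuous (g^~ v0)}.
  have e1 := is_deriveMf (is_y1u Iu0 Jv0) (dc1 Iu0).2.
  have e2 := is_deriveMf (is_y2u Iu0 Jv0) (dc2 Iu0).2.
  have e := is_deriveDf e1 e2.
  have ek := is_deriveMf (is_derive_cst (r ^+ 2) u0 1)
    (is_deriveMf (dh Iu0).2 (dh Iu0).2).
  have := is_deriveBf (is_deriveMf e e) ek.
  by move/is_derive_continuous.
have : \forall u \near u0, I u /\ 0 < g u v0.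
  near=> u; split; near: u; first exact: near_open.
  exact: cvgr_gt cg _ g0.
case=> e /= e0 sub.
have {}sub u : u0 - e < u < u0 + e -> I u /\ 0 < g u v0.
  by move=> ue; apply: sub; rewrite /ball /= distrC ltr_distl.
have mid : u0 - e < u0 < u0 + e by rewrite ltrBlDr ltrDl e0.
near=> u; apply: (@is_derive0_itv _ h (u0 - e) (u0 + e)) => //.
  move=> t /sub[It gt0]; have [<-|kt] := eqVneq (k1 t) 0; first exact: (dh It).1.
  (* Where h' is nonzero, |c'| = |h'| turns [g] into (y . c')^2 - |y|^2 |c'|^2, which is minus a
     square by Lagrange's identity and cannot be positive. *)
  have [E _ _] := leaf_equations It Jv0 kt.
  move: gt0; rewrite /g -E -(circ It Jv0) ltNge => /negP; case.
  rewrite -oppr_ge0 opprB.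
  rewrite (_ : _ - _ = (y1 t v0 * a2 t - y2 t v0 * a1 t) ^+ 2) ?sqr_ge0 //.
  by ring.
by rewrite -ltr_distl; near: u; exists e => //= y; rewrite /ball /= distrC.
Unshelve. all: by end_near. Qed.

End Leaves.

Lemma local_classification u0 v0 : I u0 -> J v0 ->
  (exists z, \forall u \near u0, forall v, J v -> P [::] u v 0 2 = z) \/
  (exists e1 e2 d1 d2, e1 ^+ 2 + e2 ^+ 2 = 1 /\
    \forall u \near u0, forall v, J v -> cylinder r e1 e2 d1 d2 (P [::] u v)).
Proof.
move=> Iu0 Jv0.
have [[a1 [b1 dc1]] [a2 [b2 dc2]]] := twice_diff_centre Jv0.
have [k1 [k2 dh]] : twice_diff I h.
  by apply: twice_diff_eq oI _ (td [::] 2 Jv0) => u Iu; rewrite heightP.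
have [k0|k0] := eqVneq (k1 u0) 0; [left|right].
  exists (h u0).
  have H := flat_leaves dc1 dc2 dh Iu0 Jv0 k0.
  near=> u; have Iu : I u by near: u; exact: near_open.
  by move=> v Jv; rewrite heightP //; near: u.
have [e1 [e2 [d1 [d2 [e H]]]]] := steep_leaves dc1 dc2 dh Iu0 Jv0 k0.
exists e1, e2, d1, d2; split=> //.
near=> u; have Iu : I u by near: u; exact: near_open.
move=> v Jv; rewrite /cylinder /= heightP // -(circleP Iu Jv).
have [<- <-] : c1 u - h u * e1 = d1 /\ c2 u - h u * e2 = d2 by near: u.
by congr (_ ^+ 2 + _ ^+ 2); ring.
Unshelve. all: by end_near. Qed.

End CircleFoliation.

(** * Uniqueness of the local model *)

Section CylinderTangent.
Context {R : realType}.
Implicit Types (x y t : 'rV[R]_3).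

Lemma mulmx_col3 x (n0 n1 n2 : R) :
  x *m (\col_i [:: n0; n1; n2]`_i) = (x 0 0 * n0 + x 0 1 * n1 + x 0 2 * n2)%:M.
Proof.
apply/rowP => i; rewrite ord1 !mxE !big_ord_recl big_ord0 addr0 addrA !mxE /=.
by rewrite mulr1n; congr (_ + _ * _ + _ * _); congr (x _ _); exact: val_inj.
Qed.

Lemma span2_covector x y t (n0 n1 n2 : R) : row_free (col_mx x y) ->
  [|| n0 != 0, n1 != 0 | n2 != 0] ->
  x 0 0 * n0 + x 0 1 * n1 + x 0 2 * n2 = 0 ->
  y 0 0 * n0 + y 0 1 * n1 + y 0 2 * n2 = 0 ->
  t 0 0 * n0 + t 0 1 * n1 + t 0 2 * n2 = 0 -> span2 x y t.
Proof.
move=> fr n xn yn tn; apply: (span2_kernel (n := \col_i [:: n0; n1; n2]`_i) fr);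
  rewrite ?mulmx_col3 ?xn ?yn ?tn ?raddf0 //.
apply: contraTneq n => /colP n.
have := n 0; have := n 1; have := n 2; rewrite !mxE /= => -> -> ->.
by rewrite eqxx.
Qed.

Lemma span2_vanish x y t (n0 n1 n2 : R) :
  x 0 0 * n0 + x 0 1 * n1 + x 0 2 * n2 = 0 ->
  y 0 0 * n0 + y 0 1 * n1 + y 0 2 * n2 = 0 -> span2 x y t ->
  t 0 0 * n0 + t 0 1 * n1 + t 0 2 * n2 = 0.
Proof.
move=> xn yn [a _ [b _ <-]]; rewrite !mxE.
transitivity (a * (x 0 0 * n0 + x 0 1 * n1 + x 0 2 * n2)
  + b * (y 0 0 * n0 + y 0 1 * n1 + y 0 2 * n2)); first by ring.
by rewrite xn yn !mulr0 addr0.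
Qed.

End CylinderTangent.

Section SliceDerivatives.
Context {R : realType}.

Lemma open_slices (O : set (R * R)) u v : open O -> O (u, v) ->
  (\forall s \near u, O (s, v)) /\ (\forall s \near v, O (u, s)).
Proof.
move=> oO Ouv; have nO : nbhs (u, v) O by apply: open_nbhs_nbhs.
have [[U V] /= [nU nV] UV] := nO; split.
  by apply: filterS nU => s Us; apply: UV; split=> //=; exact: nbhs_singleton nV.
by apply: filterS nV => s Vs; apply: UV; split=> //=; exact: nbhs_singleton nU.
Qed.

Lemma open_setX (I J : set R) : open I -> open J -> open (I `*` J).
Proof.
move=> oI oJ; rewrite openE => -[u v] [Iu Jv]; exists (I, J) => //.
by split; apply: open_nbhs_nbhs; split.
Qed.

Variables (I J : set R) (P : seq bool -> R -> R -> 'rV[R]_3).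
Hypothesis jP : jet_on I J P.
Variables (O : set (R * R)).
Hypotheses (oO : open O) (OIJ : forall u v, O (u, v) -> I u /\ J v).

Lemma jet_cst_linear (n0 n1 n2 n : R) :
  (forall u v, O (u, v) -> P [::] u v 0 0 * n0 + P [::] u v 0 1 * n1
    + P [::] u v 0 2 * n2 = n) ->
  forall u v, O (u, v) -> forall b,
    P [:: b] u v 0 0 * n0 + P [:: b] u v 0 1 * n1 + P [:: b] u v 0 2 * n2 = 0.
Proof.
move=> H u v Ouv b; have [Iu Jv] := OIJ Ouv; have [nu nv] := open_slices oO Ouv.
case: b.
  have e i (k : R) := is_deriveMf (jP [::] i Iu Jv).1 (is_derive_cst k u 1).
  have := is_derive_near_cst (is_deriveDf (is_deriveDf (e 0 n0) (e 1 n1)) (e 2 n2)).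
  move=> /(_ n) E; rewrite -[RHS]E; first by rewrite /=; ring.
  by near=> s; apply: H; near: s.
have e i (k : R) := is_deriveMf (jP [::] i Iu Jv).2 (is_derive_cst k v 1).
have := is_derive_near_cst (is_deriveDf (is_deriveDf (e 0 n0) (e 1 n1)) (e 2 n2)).
move=> /(_ n) E; rewrite -[RHS]E; first by rewrite /=; ring.
by near=> s; apply: H; near: s.
Unshelve. all: by end_near. Qed.

Variables (r e1 e2 d1 d2 : R).
Hypothesis cyl : forall u v, O (u, v) -> cylinder r e1 e2 d1 d2 (P [::] u v).

Let y1 u v := P [::] u v 0 0 - d1 - P [::] u v 0 2 * e1.
Let y2 u v := P [::] u v 0 1 - d2 - P [::] u v 0 2 * e2.

(** The covector is half the gradient of the quadratic function that defines the cylinder. *)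
Lemma cylinder_covector u v b : O (u, v) ->
  P [:: b] u v 0 0 * y1 u v + P [:: b] u v 0 1 * y2 u v
  + P [:: b] u v 0 2 * - (e1 * y1 u v + e2 * y2 u v) = 0.
Proof.
move=> Ouv; have [Iu Jv] := OIJ Ouv; have [nu nv] := open_slices oO Ouv.
have : (2 : R) != 0 by rewrite pnatr_eq0.
move/mulfI; apply; rewrite mulr0.
case: b.
  have e i := (jP [::] i Iu Jv).1.
  have f (i : 'I_3) (d k : R) := is_deriveBf (is_deriveBf (e i) (is_derive_cst d u 1))
    (is_deriveMf (e 2) (is_derive_cst k u 1)).
  have := is_derive_near_cst (is_deriveDf
    (is_deriveMf (f 0 d1 e1) (f 0 d1 e1)) (is_deriveMf (f 1 d2 e2) (f 1 d2 e2))).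
  move=> /(_ (r ^+ 2)) E; rewrite -[RHS]E; first by rewrite /y1 /y2 /=; ring.
  by near=> s; rewrite -!expr2; apply: cyl; near: s.
have e i := (jP [::] i Iu Jv).2.
have f (i : 'I_3) (d k : R) := is_deriveBf (is_deriveBf (e i) (is_derive_cst d v 1))
  (is_deriveMf (e 2) (is_derive_cst k v 1)).
have := is_derive_near_cst (is_deriveDf
  (is_deriveMf (f 0 d1 e1) (f 0 d1 e1)) (is_deriveMf (f 1 d2 e2) (f 1 d2 e2))).
move=> /(_ (r ^+ 2)) E; rewrite -[RHS]E; first by rewrite /y1 /y2 /=; ring.
by near=> s; rewrite -!expr2; apply: cyl; near: s.
Unshelve. all: by end_near. Qed.

Hypothesis r0 : 0 < r.
Hypothesis regP : forall u v, O (u, v) ->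
  row_free (col_mx (P [:: true] u v) (P [:: false] u v)).

Lemma cylinder_radius_neq0 u v : O (u, v) -> (y1 u v != 0) || (y2 u v != 0).
Proof.
move=> /cyl; rewrite /cylinder /= -/(y1 u v) -/(y2 u v) => E.
rewrite -negb_and; apply/negP => /andP[/eqP z1 /eqP z2].
by move/eqP: E; rewrite z1 z2 !expr0n addr0 eq_sym sqrf_eq0 gt_eqF.
Qed.

Lemma cylinder_tangent u v t : O (u, v) ->
  span2 (P [:: true] u v) (P [:: false] u v) t <->
  t 0 0 * y1 u v + t 0 1 * y2 u v
  + t 0 2 * - (e1 * y1 u v + e2 * y2 u v) = 0.
Proof.
move=> Ouv; split.
  by apply: span2_vanish; exact: cylinder_covector.
apply: span2_covector; rewrite ?cylinder_covector //; first exact: regP.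
by rewrite orbA cylinder_radius_neq0.
Qed.

(** A relation affine in y is affine in the position, so its differential kills the tangent vector
    (-y2, y1, 0) of the horizontal circle. The outcome is a relation of the same kind with w turned
    by a right angle, so the lemma can be iterated. *)
Lemma cylinder_rotate w1 w2 w :
  (forall u v, O (u, v) -> y1 u v * w1 + y2 u v * w2 = w) ->
  forall u v, O (u, v) -> y1 u v * w2 + y2 u v * - w1 = 0.
Proof.
move=> H u v Ouv.
have L : forall u v, O (u, v) -> P [::] u v 0 0 * w1 + P [::] u v 0 1 * w2
    + P [::] u v 0 2 * - (e1 * w1 + e2 * w2) = w + d1 * w1 + d2 * w2.
  by move=> s t /H <-; rewrite /y1 /y2; ring.
have tan : span2 (P [:: true] u v) (P [:: false] u v) (vec3 (- y2 u v) (y1 u v) 0).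
  by apply/(cylinder_tangent _ Ouv); rewrite !vec3E; ring.
have := span2_vanish (jet_cst_linear L Ouv true) (jet_cst_linear L Ouv false) tan.
by rewrite !vec3E => E; rewrite -[RHS]E; ring.
Qed.

(** Two quarter turns make the nonzero vector y orthogonal both to w and to w turned by a right
    angle. *)
Lemma cylinder_linear w1 w2 w u v : O (u, v) ->
  (forall u v, O (u, v) -> y1 u v * w1 + y2 u v * w2 = w) -> w1 = 0 /\ w2 = 0.
Proof.
move=> Ouv H; have H1 := cylinder_rotate H; have H2 := cylinder_rotate H1.
have := H1 u v Ouv; have := H2 u v Ouv; have := cyl Ouv.
rewrite /cylinder /= -/(y1 u v) -/(y2 u v).
move: (y1 u v) (y2 u v) => a b E h2 h1.
have ab : a ^+ 2 + b ^+ 2 != 0 by rewrite E sqrf_eq0 gt_eqF.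
split; apply: (mulIf ab); rewrite mul0r.
  transitivity (- a * (a * - w1 + b * - w2) - b * (a * w2 + b * - w1)); first by ring.
  by rewrite h1 h2; ring.
transitivity (- b * (a * - w1 + b * - w2) + a * (a * w2 + b * - w1)); first by ring.
by rewrite h1 h2; ring.
Qed.

(** The ruling direction (e1, e2, 1) is tangent to the surface and not horizontal. *)
Lemma cylinder_not_planar z u v : O (u, v) ->
  (forall u v, O (u, v) -> P [::] u v 0 2 = z) -> False.
Proof.
move=> Ouv H.
have L : forall u v, O (u, v) -> P [::] u v 0 0 * 0 + P [::] u v 0 1 * 0
    + P [::] u v 0 2 * 1 = z.
  by move=> s t /H <-; ring.
have tan : span2 (P [:: true] u v) (P [:: false] u v) (vec3 e1 e2 1).
  by apply/(cylinder_tangent _ Ouv); rewrite !vec3E; ring.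
have := span2_vanish (jet_cst_linear L Ouv true) (jet_cst_linear L Ouv false) tan.
by rewrite !vec3E => /eqP; rewrite !mulr0 mulr1 !add0r oner_eq0.
Qed.

End SliceDerivatives.

Section Uniqueness.
Context {R : realType}.
Variables (I J : set R) (P : seq bool -> R -> R -> 'rV[R]_3).
Hypothesis jP : jet_on I J P.
Variables (O : set (R * R)) (r : R).
Hypotheses (oO : open O) (OIJ : forall u v, O (u, v) -> I u /\ J v) (r0 : 0 < r).
Hypothesis regP : forall u v, O (u, v) ->
  row_free (col_mx (P [:: true] u v) (P [:: false] u v)).

Lemma cylinder_unique e1 e2 d1 d2 e1' e2' d1' d2' u v : O (u, v) ->
  (forall u v, O (u, v) -> cylinder r e1 e2 d1 d2 (P [::] u v)) ->
  (forall u v, O (u, v) -> cylinder r e1' e2' d1' d2' (P [::] u v)) ->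
  [/\ e1 = e1', e2 = e2', d1 = d1' & d2 = d2'].
Proof.
move=> Ouv C C'.
have T := cylinder_tangent jP oO OIJ C r0 regP.
have T' := cylinder_tangent jP oO OIJ C' r0 regP.
(* The rulings of the second cylinder are tangent to the first one, which says y . (e' - e) = 0. *)
have [] : e1' - e1 = 0 /\ e2' - e2 = 0.
  apply: (cylinder_linear jP oO OIJ C r0 regP Ouv (w := 0)) => s t Ost.
  have /(T _ _ _ Ost) : span2 (P [:: true] s t) (P [:: false] s t) (vec3 e1' e2' 1).
    by apply/(T' _ _ _ Ost); rewrite !vec3E; ring.
  by rewrite !vec3E => E; rewrite -[RHS]E; ring.
move=> /eqP; rewrite subr_eq0 => /eqP h1 /eqP; rewrite subr_eq0 => /eqP h2.
(* With equal rulings, the circle direction of the first cylinder is tangent to the second one, so y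
   is orthogonal to d - d' turned by a right angle. *)
have [] : d2 - d2' = 0 /\ d1' - d1 = 0.
  apply: (cylinder_linear jP oO OIJ C r0 regP Ouv (w := 0)) => s t Ost.
  pose y1 := P [::] s t 0 0 - d1 - P [::] s t 0 2 * e1.
  pose y2 := P [::] s t 0 1 - d2 - P [::] s t 0 2 * e2.
  have /(T' _ _ _ Ost) : span2 (P [:: true] s t) (P [:: false] s t)
      (vec3 (- y2) y1 0).
    by apply/(T _ _ _ Ost); rewrite !vec3E /y1 /y2; ring.
  by rewrite !vec3E h1 h2 /y1 /y2 => E; rewrite -[RHS]E; ring.
by move=> /eqP; rewrite subr_eq0 => /eqP -> /eqP; rewrite subr_eq0 => /eqP ->.
Qed.

End Uniqueness.

(** * From local pieces to the whole connected surface *)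

Section ConnectedGluing.
Context {M : topologicalType}.

(** The interior of [Q t] is closed as well as open: a point outside it carries another label, which
    persists nearby and excludes [t] there by uniqueness. *)
Lemma connected_glue (T : Type) (Q : T -> set M) (m0 : M) :
  connected [set: M] -> (forall m : M, exists t, nbhs m (Q t)) ->
  (forall (m : M) t t', nbhs m (Q t) -> nbhs m (Q t') -> t = t') ->
  exists t, forall m, Q t m.
Proof.
move=> conn ex uniq; have [t nt] := ex m0; exists t.
suff all : interior (Q t) = [set: M].
  by move=> m; apply: interior_subset; rewrite all.
apply: conn; first by exists m0.
  by exists (interior (Q t)); rewrite ?setTI //; exact: open_interior.
exists (interior (Q t)); rewrite ?setTI // -openC openE => m /= ntm.
have [t' nt'] := ex m; apply: filterS (nbhs_interior nt') => m' m't' m't.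
by apply: ntm; rewrite (uniq _ _ _ m't m't').
Qed.

End ConnectedGluing.

Section Pieces.
Context {R : realType}.

(** Labels of the local models, [inl] for horizontal planes and [inr] for cylinders. The condition
    |e| = 1 is put into the set so that the gluing carries it along. *)
Definition piece (r : R) (t : R + R * R * R * R) : set 'rV[R]_3 :=
  match t with
  | inl z => [set x | x 0 2 = z]
  | inr (e1, e2, d1, d2) =>
      [set x | e1 ^+ 2 + e2 ^+ 2 = 1 /\ cylinder r e1 e2 d1 d2 x]
  end.

End Pieces.

Section Surface.
Context {R : realType} {M : topologicalType}.
Variables (f : M -> 'rV[R]_3) (A : set (chart R M)) (B : 'M[R]_3).
Hypotheses (isoB : lorentz_isometry B) (unitB : B \in unitmx).
Hypothesis surf : immersed_surface f A.

Definition chart_jet phi w u v : 'rV[R]_3 := partial w (in_chart f phi) u v *m B.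

Lemma chart_jet_on phi : A phi -> jet_on (chart_u phi) (chart_v phi) (chart_jet phi).
Proof.
move=> Aphi; case: surf => _ _ /(_ phi Aphi)[_ _ sm _] _.
exact/jet_mul/smooth_jet.
Qed.

Lemma chart_jet_regular phi u v : A phi -> chart_u phi u -> chart_v phi v ->
  row_free (col_mx (chart_jet phi [:: true] u v) (chart_jet phi [:: false] u v)).
Proof.
move=> Aphi Iu Jv; case: surf => _ _ /(_ phi Aphi)[_ _ _ reg] _.
by rewrite -mul_col_mx /row_free mxrankMfree ?row_free_unit //; exact: reg.
Qed.

Lemma chart_jet_mc_form phi u v : zero_mean_curvature f A ->
  A phi -> chart_u phi u -> chart_v phi v ->
  let P w := chart_jet phi w u v in
  gram (P [:: true]) (P [:: false]) != 0 ->
  mc_form (P [:: true]) (P [:: false]) (P [:: true; true]) (P [:: true; false])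
    (P [:: false; false]) = 0.
Proof.
move=> zmc Aphi Iu Jv P; rewrite /P /chart_jet gram_mul // mc_form_mul //.
set X := in_chart f phi => nd.
have := zmc phi u v Aphi (conj Iu Jv) (gram_nondegenerate nd).
by move/(mean_curvature_eq0 nd) ->; rewrite mulr0.
Qed.

Lemma chart_image_nbhs phi u v (O : set (R * R)) : A phi ->
  chart_u phi u -> chart_v phi v -> nbhs (u, v) O ->
  nbhs (chart_map phi u v)
    [set chart_map phi q.1 q.2 | q in O `&` chart_dom phi].
Proof.
move=> Aphi Iu Jv nO.
case: surf => _ _ /(_ phi Aphi)[[oI _ oJ _] [_ _ op] _ _] _.
have oD : open (chart_dom phi) by exact: open_setX.
have nD : nbhs (u, v) (chart_dom phi) by apply: open_nbhs_nbhs.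
have nOD : nbhs (u, v) (O `&` chart_dom phi) by exact: filterI.
have sub : interior (O `&` chart_dom phi) `<=` chart_dom phi.
  by move=> q /interior_subset[].
apply: filterS (open_nbhs_nbhs (conj (op _ (@open_interior _ _) sub) _)).
  by apply: image_subset; exact: interior_subset.
by exists (u, v).
Qed.

Variables (nu : 'rV[R]_3) (k r : R) (rad : M -> R).
Hypotheses (k0 : k != 0) (nuB : nu *m B = vec3 0 0 k) (r0 : 0 < r).
Hypothesis zmc : zero_mean_curvature f A.
Hypothesis fol : foliated_by_circles f A nu rad.
Hypothesis radr : forall m, rad m = r.

Lemma circle_horizontal c rho x : circle nu c rho x ->
  (x *m B) 0 2 = (c *m B) 0 2 /\
  ((x *m B) 0 0 - (c *m B) 0 0) ^+ 2 + ((x *m B) 0 1 - (c *m B) 0 1) ^+ 2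
  = rho ^+ 2.
Proof.
rewrite /circle /= -isoB nuB -(isoB (x - c)) mulmxBl /lorentz !vec3E !mxE.
rewrite !mulr0 !add0r => -[/eqP]; rewrite oppr_eq0 mulf_eq0 (negbTE k0) orbF.
by move=> /eqP z <-; rewrite z; split; [apply/eqP; rewrite -subr_eq0 z|ring].
Qed.

Lemma foliated_chart (m : M) : exists phi u v (c : R -> 'rV[R]_3),
  [/\ A phi, chart_u phi u, chart_v phi v, chart_map phi u v = m &
    forall s t, chart_u phi s -> chart_v phi t ->
      chart_jet phi [::] s t 0 2 = c s 0 2 /\
      (chart_jet phi [::] s t 0 0 - c s 0 0) ^+ 2
      + (chart_jet phi [::] s t 0 1 - c s 0 1) ^+ 2 = r ^+ 2].
Proof.
have [phi [Aphi [[u v] [/= Iu Jv] mE] H]] := fol m.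
have ex s : exists c : 'rV[R]_3, chart_u phi s -> forall t, chart_v phi t ->
    circle nu c r (in_chart f phi s t).
  have [Is|nIs] := pselect (chart_u phi s); last by exists 0.
  have [c [rho [_ Hc]]] := H s Is; exists c => _ t Jt.
  by have [+ e] := Hc t Jt; rewrite -e radr.
have [c Hc] := choice ex.
(* The centres are merely chosen, with no regularity in s; [twice_diff_centre] supplies it. *)
exists phi, u, v, (fun s => c s *m B); split=> // s t Is Jt.
exact: circle_horizontal (Hc s Is t Jt).
Qed.

Lemma local_piece (m : M) : exists t, nbhs m [set m' | piece r t (f m' *m B)].
Proof.
have [phi [u [v [c [Aphi Iu Jv <- H]]]]] := foliated_chart m.
have [oI oJ] : open (chart_u phi) /\ open (chart_v phi).
  by case: surf => _ _ /(_ phi Aphi)[[? _ ? _] _ _ _] _.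
have := @local_classification _ _ _ _ r (fun s => c s 0 0) (fun s => c s 0 1)
  (fun s => c s 0 2) oI oJ (chart_jet_on Aphi) r0
  (fun s t Is Jt => chart_jet_regular Aphi Is Jt)
  (fun s t Is Jt => chart_jet_mc_form zmc Aphi Is Jt)
  (fun s t Is Jt => (H s t Is Jt).1) (fun s t Is Jt => (H s t Is Jt).2)
  u v Iu Jv.
have fill (Q : set 'rV[R]_3) : (\forall s \near u, forall t, chart_v phi t ->
    Q (chart_jet phi [::] s t)) ->
    nbhs (chart_map phi u v) [set m' | Q (f m' *m B)].
  move=> nQ; have nO : nbhs (u, v) ([set s | forall t, chart_v phi t ->
      Q (chart_jet phi [::] s t)] `*` [set: R]).
    by exists ([set s | forall t, chart_v phi t -> Q (chart_jet phi [::] s t)],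
      setT) => //; split=> //; exact: filterT.
  apply: filterS (chart_image_nbhs Aphi Iu Jv nO).
  by move=> _ [[s t] [[/= Qs _] [_ Jt]] <-]; exact: Qs.
case=> [[z Hz]|[e1 [e2 [d1 [d2 [e Hc]]]]]].
  by exists (inl z); exact: (fill [set x | x 0 2 = z]).
exists (inr (e1, e2, d1, d2)) => /=; apply: (fill [set x | _ /\ _ x]).
by apply: filterS Hc => s Hs t Jt; split=> //; exact: Hs.
Qed.

(** Both labels hold on an open subset of one chart, where a plane excludes a cylinder and a
    cylinder determines its parameters. *)
Lemma piece_unique (m : M) t t' : nbhs m [set m' | piece r t (f m' *m B)] ->
  nbhs m [set m' | piece r t' (f m' *m B)] -> t = t'.
Proof.
move=> nt nt'; case: (surf) => _ _ imm /(_ m)[phi Aphi [[u v] [/= Iu Jv] mE]].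
have [[oI _ oJ _] [cont _ _] _ _] := imm phi Aphi.
pose W := [set q | piece r t (f (chart_map phi q.1 q.2) *m B) /\
  piece r t' (f (chart_map phi q.1 q.2) *m B)].
have nW : nbhs (u, v) W.
  have Duv : (u, v) \in chart_dom phi by apply/mem_set.
  have : nbhs m ([set m' | piece r t (f m' *m B)]
    `&` [set m' | piece r t' (f m' *m B)]) by exact: filterI.
  by rewrite -mE => n2; exact: (cont (u, v) Duv _ n2).
have oD : open (chart_dom phi) by exact: open_setX.
pose O := interior W `&` chart_dom phi.
have oO : open O by apply: openI => //; exact: open_interior.
have OIJ s q : O (s, q) -> chart_u phi s /\ chart_v phi q by case=> _ [].
have OW s q : O (s, q) -> piece r t (chart_jet phi [::] s q) /\
    piece r t' (chart_jet phi [::] s q) by case=> /interior_subset.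
have Ouv : O (u, v) by [].
have regO s q : O (s, q) ->
    row_free (col_mx (chart_jet phi [:: true] s q) (chart_jet phi [:: false] s q)).
  by move=> /OIJ[? ?]; exact: chart_jet_regular.
have jP := chart_jet_on Aphi.
have np e1 e2 d1 d2 z : (forall s q, O (s, q) ->
    cylinder r e1 e2 d1 d2 (chart_jet phi [::] s q)) ->
    (forall s q, O (s, q) -> chart_jet phi [::] s q 0 2 = z) -> False.
  by move=> C H; exact: (cylinder_not_planar jP oO OIJ C r0 regO Ouv H).
case: t nt @W nW O oO OIJ OW Ouv regO np => [z|[[[e1 e2] d1] d2]] _;
case: t' nt' => [z'|[[[e1' e2'] d1'] d2']] _ W nW O oO OIJ OW Ouv regO np.
- by have [<- <-] := OW u v Ouv.
- by exfalso; apply: (np e1' e2' d1' d2' z) => s q /OW[] //= _ [].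
- by exfalso; apply: (np e1 e2 d1 d2 z') => s q /OW[] //= [].
- have [||-> -> -> ->] // := @cylinder_unique _ _ _ _ jP _ r oO OIJ r0 regO
    e1 e2 d1 d2 e1' e2' d1' d2' u v Ouv.
    by move=> s q /OW[[]].
  by move=> s q /OW[_ []].
Qed.

Lemma global_piece (m0 : M) : exists t, forall m, piece r t (f m *m B).
Proof.
case: surf => _ conn _ _.
exact: (connected_glue (Q := fun t => [set m' | piece r t (f m' *m B)]) m0 conn
  local_piece piece_unique).
Qed.

End Surface.

(** * The planar case *)

Section IntermediateValue.
Context {R : realType}.
Implicit Types (f : R -> R).

Lemma ivt_zero f a b : a <= b -> (forall x, a <= x <= b -> {for x, continuous f}) ->
  f a * f b < 0 -> exists2 c, a <= c <= b & f c = 0.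
Proof.
move=> ab cf fab.
have wf : {within `[a, b], continuous f}.
  apply: continuous_in_subspaceT => u /set_mem /= uab.
  by apply: cf; move: uab; rewrite in_itv.
have [|c cab fc] := IVT ab wf (v := 0); last by exists c; rewrite // -in_itv.
rewrite ge_min le_max; have [fa|fa|fa] := ltrgt0P (f a).
- by rewrite -(pmulr_rle0 _ fa) (ltW fab) orbT.
- by rewrite -(nmulr_rle0 _ fa) (ltW fab) orbT.
- by move: fab; rewrite fa mul0r ltxx.
Qed.

(** Near x the difference quotients have the sign of d on both sides, so f changes sign. Multiplying
    them by d avoids distinguishing the sign of d. *)
Lemma derive_sign_change f (x d e : R) : is_derive x 1 f d -> d != 0 -> f x = 0 ->
  0 < e -> exists a b, [/\ x - e < a, a < x, x < b, b < x + e & f a * f b < 0].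
Proof.
move=> [df fd] d0 fx e0.
have : \forall t \near (0 : R)^', 0 < d * (t^-1 *: (f (t *: 1 + x) - f x)).
  have c : d * (t^-1 *: (f (t *: 1 + x) - f x)) @[t --> (0 : R)^'] --> d * d.
    by apply: cvgM; [exact: cvg_cst|rewrite -fd; exact: df].
  by apply: cvgr_gt c _ _; rewrite -expr2 exprn_even_gt0.
rewrite fx; case=> e' /= e'0 H; pose t : R := Num.min e e' / 2.
have t0 : 0 < t by rewrite divr_gt0 // lt_min e0.
have [te te'] : t < e /\ t < e'.
  by split; rewrite (@lt_le_trans _ _ (Num.min e e')) ?ge_min ?lexx ?orbT //
    /t ltr_pdivrMr // ltr_pMr ?lt_min ?e0 // ltr1n.
exists (x - t), (x + t); split; rewrite ?ltrD2l ?ltrN2 ?ltrDl ?gtrDl ?oppr_lt0 //.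
have h1 := H t; have h2 := H (- t).
have {h1} : 0 < d * (t^-1 * f (x + t)).
  have := h1; rewrite /ball_ /= sub0r normrN gtr0_norm // => /(_ te' (lt0r_neq0 t0)).
  by rewrite [t%:A]mulr1 subr0 addrC.
have {h2} : 0 < d * ((- t)^-1 * f (x - t)).
  have := h2; rewrite /ball_ /= sub0r opprK gtr0_norm //.
  rewrite oppr_eq0 => /(_ te' (lt0r_neq0 t0)).
  by rewrite [(- t)%:A]mulr1 subr0 addrC.
have n : - (d / t) ^+ 2 < 0.
  by rewrite oppr_lt0 exprn_even_gt0 //= mulf_neq0 // invr_eq0 lt0r_neq0.
move=> h2 h1; rewrite -(nmulr_rgt0 _ n).
have -> : - (d / t) ^+ 2 * (f (x - t) * f (x + t))
    = d * (t^-1 * f (x + t)) * (d * ((- t)^-1 * f (x - t))).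
  by rewrite invrN; field; rewrite lt0r_neq0.
exact: mulr_gt0.
Qed.

End IntermediateValue.

Section FlatOpen.
Context {R : realType}.
Variables (I J : set R) (P : seq bool -> R -> R -> 'rV[R]_3) (r : R)
  (c1 c2 a1 a2 : R -> R) (u0 v0 : R) (O : set (R * R)).
Hypotheses (oI : open I) (oJ : open J) (jP : jet_on I J P) (r0 : 0 < r).
Hypotheses (Iu0 : I u0) (Jv0 : J v0) (nO : nbhs (u0, v0) O).
Hypothesis circleP : forall u v, I u -> J v ->
  (P [::] u v 0 0 - c1 u) ^+ 2 + (P [::] u v 0 1 - c2 u) ^+ 2 = r ^+ 2.
Hypothesis dc1 : forall u, I u -> is_derive u 1 c1 (a1 u).
Hypothesis dc2 : forall u, I u -> is_derive u 1 c2 (a2 u).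
Hypothesis contP : forall i,
  {for (u0, v0), continuous (fun q => P [::] q.1 q.2 0 i)}.

Let y1 u v := P [::] u v 0 0 - c1 u.
Let y2 u v := P [::] u v 0 1 - c2 u.
Let s0 := y1 u0 v0.
Let t0 := y2 u0 v0.
Let p1 := P [::] u0 v0 0 0.
Let p2 := P [::] u0 v0 0 1.

Hypothesis transverse : s0 * a1 u0 + t0 * a2 u0 != 0.
Hypothesis tangent0 :
  s0 * P [:: false] u0 v0 0 0 + t0 * P [:: false] u0 v0 0 1 = 0.
Hypothesis dv0 : (P [:: false] u0 v0 0 0 != 0) || (P [:: false] u0 v0 0 1 != 0).

Let nrm2 : s0 ^+ 2 + t0 ^+ 2 = r ^+ 2. Proof. exact: circleP. Qed.

(* For q near p, the leaf u whose circle passes through q is found by the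
   intermediate value theorem, and then the position of q on that leaf. *)
Lemma flat_open : \forall q \near (p1, p2), exists u v,
  [/\ I u, J v, O (u, v), P [::] u v 0 0 = q.1 & P [::] u v 0 1 = q.2].
Proof.
(* [phi] is r times the component of y tangential to the circle at the base point; [psi q u]
   vanishes when q lies on the circle of the leaf u. *)
pose phi u v := s0 * y2 u v - t0 * y1 u v.
pose psi (q : R * R) u :=
  (q.1 - c1 u) * (q.1 - c1 u) + (q.2 - c2 u) * (q.2 - c2 u) - r ^+ 2.
have cc1 u : I u -> {for u, continuous c1}.
  by move=> Iu; exact: is_derive_continuous (dc1 Iu).
have cc2 u : I u -> {for u, continuous c2}.
  by move=> Iu; exact: is_derive_continuous (dc2 Iu).
have cPu i u v : I u -> J v -> {for u, continuous (fun s => P [::] s v 0 i)}.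
  by move=> Iu Jv; exact: is_derive_continuous (jP [::] i Iu Jv).1.
have cPv i u v : I u -> J v -> {for v, continuous (fun s => P [::] u s 0 i)}.
  by move=> Iu Jv; exact: is_derive_continuous (jP [::] i Iu Jv).2.
have cphi_v u v : I u -> J v -> {for v, continuous (phi u)}.
  move=> Iu Jv; rewrite /phi /y1 /y2.
  by apply: cvgB; (apply: cvgM; [exact: cvg_cst|]); apply: cvgB;
    [exact: cPv|exact: cvg_cst|exact: cPv|exact: cvg_cst].
have cphi_u u v : I u -> J v -> {for u, continuous (phi^~ v)}.
  move=> Iu Jv; rewrite /phi /y1 /y2.
  by apply: cvgB; (apply: cvgM; [exact: cvg_cst|]); apply: cvgB;
    [exact: cPu|exact: cc2|exact: cPu|exact: cc1].
have cpsi q u : I u -> {for u, continuous (psi q)}.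
  move=> Iu; rewrite /psi; apply: cvgB; last exact: cvg_cst.
  by apply: cvgD; apply: cvgM; apply: cvgB;
    do [exact: cvg_cst|exact: cc1|exact: cc2].
have nbox : \forall q \near (u0, v0), [/\ I q.1, J q.2, O q
    & 0 < s0 * y1 q.1 q.2 + t0 * y2 q.1 q.2].
  have cu (c : R -> R) : {for u0, continuous c} -> c q.1 @[q --> (u0, v0)] --> c u0.
    by move=> cc; apply: (@cvg_comp _ _ _ fst c _ (nbhs u0)); [exact: cvg_fst|exact: cc].
  have cN : s0 * y1 q.1 q.2 + t0 * y2 q.1 q.2 @[q --> (u0, v0)]
      --> s0 * s0 + t0 * t0.
    by apply: cvgD; (apply: cvgM; [exact: cvg_cst|]); apply: cvgB;
      do [exact: contP|apply: cu; do [exact: cc1|exact: cc2]].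
  have nI : nbhs (u0, v0) (I `*` J).
    by apply: open_nbhs_nbhs; split=> //; exact: open_setX.
  have N0 : 0 < s0 * s0 + t0 * t0 by rewrite -!expr2 nrm2 exprn_gt0.
  near=> q; split.
  - by have [] : (I `*` J) q by near: q.
  - by have [] : (I `*` J) q by near: q.
  - by near: q.
  - by near: q; exact: cvgr_gt cN _ N0.
have [e e0 box] : exists2 e, 0 < e & forall u v, u0 - e < u < u0 + e ->
    v0 - e < v < v0 + e ->
    [/\ I u, J v, O (u, v) & 0 < s0 * y1 u v + t0 * y2 u v].
  move: nbox => /nbhs_ballP[e /= e0 H]; exists e => // u v.
  rewrite -!ltr_distl => ue ve; apply: (H (u, v)).
  by split; rewrite /ball /= distrC.
have [v1 [v2 [v1e v10 v02 v2e vneg]]] : exists a b,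
    [/\ v0 - e < a, a < v0, v0 < b, b < v0 + e & phi u0 a * phi u0 b < 0].
  have dy1 := is_deriveBf (jP [::] 0 Iu0 Jv0).2 (is_derive_cst (c1 u0) v0 1).
  have dy2 := is_deriveBf (jP [::] 1 Iu0 Jv0).2 (is_derive_cst (c2 u0) v0 1).
  have d := is_deriveBf (is_deriveMf (is_derive_cst s0 v0 1) dy2)
    (is_deriveMf (is_derive_cst t0 v0 1) dy1).
  apply: (derive_sign_change d) => //; last first.
    by rewrite -/(y1 u0 v0) -/(y2 u0 v0) -/s0 -/t0 /= mulrC subrr.
  rewrite !mulr0 !subr0 !addr0 /=.
  apply/negP => /eqP z.
  have := dv0; rewrite -negb_and => /negP; apply.
  move: z tangent0; move: (P [:: false] u0 v0 0 0) (P [:: false] u0 v0 0 1).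
  move=> a b z t; have n : s0 ^+ 2 + t0 ^+ 2 != 0 by rewrite nrm2 sqrf_eq0 gt_eqF.
  apply/andP; split; apply/eqP; apply: (mulIf n); rewrite mul0r.
    transitivity (s0 * (s0 * a + t0 * b) - t0 * (s0 * b - t0 * a)); first by ring.
    by rewrite t z; ring.
  transitivity (t0 * (s0 * a + t0 * b) + s0 * (s0 * b - t0 * a)); first by ring.
  by rewrite t z; ring.
have ue0 : u0 - e < u0 < u0 + e by rewrite ltrBlDr ltrDl e0.
have ve1 : v0 - e < v1 < v0 + e by rewrite v1e (lt_trans v10) // ltrDl.
have ve2 : v0 - e < v2 < v0 + e by rewrite v2e andbT (lt_trans _ v02) // ltrBlDr ltrDl.
have [_ Jv1 _ _] := box u0 v1 ue0 ve1; have [_ Jv2 _ _] := box u0 v2 ue0 ve2.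
(* Tangential and normal components of q - c(u), scaled by r, in the frame of the base radius
   vector. On a circle about c(u) the tangential one fixes a point up to the sign of the normal one,
   so positivity of [nor] will single out q. *)
pose tau (q : R * (R * R)) := s0 * (q.2.2 - c2 q.1) - t0 * (q.2.1 - c1 q.1).
pose nor (q : R * (R * R)) := s0 * (q.2.1 - c1 q.1) + t0 * (q.2.2 - c2 q.1).
have nq : \forall q \near (u0, (p1, p2)),
    (phi q.1 v1 - tau q) * (phi q.1 v2 - tau q) < 0 /\ 0 < nor q.
  have cu (c : R -> R) : {for u0, continuous c} ->
      c q.1 @[q --> (u0, (p1, p2))] --> c u0.
    by move=> cc; apply: (@cvg_comp _ _ _ fst c _ (nbhs u0)); [exact: cvg_fst|exact: cc].
  have cp : q.2 @[q --> (u0, (p1, p2))] --> (p1, p2) by exact: cvg_snd.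
  have cp1 : q.2.1 @[q --> (u0, (p1, p2))] --> p1.
    by apply: (@cvg_comp _ _ _ snd fst _ (nbhs (p1, p2))); [exact: cvg_snd|exact: cvg_fst].
  have cp2 : q.2.2 @[q --> (u0, (p1, p2))] --> p2.
    by apply: (@cvg_comp _ _ _ snd snd _ (nbhs (p1, p2))); [exact: cvg_snd|exact: cvg_snd].
  have ctau : tau q @[q --> (u0, (p1, p2))] --> s0 * t0 - t0 * s0.
    by apply: cvgB; (apply: cvgM; [exact: cvg_cst|]); apply: cvgB => //;
      apply: cu; do [exact: cc1|exact: cc2].
  have cnor : nor q @[q --> (u0, (p1, p2))] --> s0 * s0 + t0 * t0.
    by apply: cvgD; (apply: cvgM; [exact: cvg_cst|]); apply: cvgB => //;
      apply: cu; do [exact: cc1|exact: cc2].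
  have N0 : 0 < s0 * s0 + t0 * t0 by rewrite -!expr2 nrm2 exprn_gt0.
  have cprod : (phi q.1 v1 - tau q) * (phi q.1 v2 - tau q)
      @[q --> (u0, (p1, p2))] --> phi u0 v1 * phi u0 v2.
    rewrite -[phi u0 v1]subr0 -[phi u0 v2]subr0.
    have -> : (0 : R) = s0 * t0 - t0 * s0 by rewrite mulrC subrr.
    by apply: cvgM; apply: cvgB => //; [apply: (cu (phi^~ v1))|apply: (cu (phi^~ v2))];
      exact: cphi_u.
  near=> q; split; near: q; first exact: cvgr_lt cprod _ vneg.
  exact: cvgr_gt cnor _ N0.
have [e' e'0 box'] : exists2 e', 0 < e' & forall u q, `|u0 - u| < e' ->
    `|p1 - q.1| < e' -> `|p2 - q.2| < e' ->
    (phi u v1 - tau (u, q)) * (phi u v2 - tau (u, q)) < 0 /\ 0 < nor (u, q).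
  move: nq => /nbhs_ballP[e' /= e'0 H]; exists e' => // u q u_ q1 q2.
  by apply: (H (u, q)).
(* The derivative of [psi] in u at the base point is - 2 y . c', nonzero by transversality, so [psi]
   changes sign across u0. *)
have [u1 [u2 [u1e u10 u02 u2e uneg]]] : exists a b,
    [/\ u0 - Num.min e e' < a, a < u0, u0 < b, b < u0 + Num.min e e'
      & psi (p1, p2) a * psi (p1, p2) b < 0].
  have d1 := is_deriveBf (is_derive_cst p1 u0 1) (dc1 Iu0).
  have d2 := is_deriveBf (is_derive_cst p2 u0 1) (dc2 Iu0).
  have d := is_deriveBf (is_deriveDf (is_deriveMf d1 d1) (is_deriveMf d2 d2))
    (is_derive_cst (r ^+ 2) u0 1).
  apply: (derive_sign_change d); last by rewrite lt_min e0.
    rewrite /= -/s0 -/t0 (_ : _ - _ = - 2 * (s0 * a1 u0 + t0 * a2 u0)).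
      by rewrite mulf_neq0 // oppr_eq0 pnatr_eq0.
    by rewrite /s0 /t0 /y1 /y2 /p1 /p2; ring.
  by rewrite /= -nrm2 /s0 /t0 /y1 /y2 /p1 /p2; ring.
have npsi : \forall q \near (p1, p2), psi q u1 * psi q u2 < 0.
  have cq u : psi q u @[q --> (p1, p2)] --> psi (p1, p2) u.
    apply: cvgB; last exact: cvg_cst.
    by apply: cvgD; apply: cvgM; apply: cvgB;
      do [exact: cvg_cst|exact: cvg_fst|exact: cvg_snd].
  exact: cvgr_lt (cvgM (cq u1) (cq u2)) _ uneg.
have nball : \forall q \near (p1, p2), `|p1 - q.1| < e' /\ `|p2 - q.2| < e'.
  by have := nbhsx_ballx (p1, p2) e' e'0; apply: filterS => q [].
near=> q.
have [q1 q2] : `|p1 - q.1| < e' /\ `|p2 - q.2| < e' by near: q.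
have uu u : u1 <= u <= u2 -> (u0 - e < u < u0 + e) /\ `|u0 - u| < e'.
  move=> /andP[uu1 uu2].
  have : u0 - Num.min e e' < u < u0 + Num.min e e'.
    by rewrite (lt_le_trans u1e) // (le_lt_trans uu2).
  rewrite -!ltr_distl lt_min => /andP[? ?]; split=> //.
  by rewrite distrC.
have [u u12 psiu] : exists2 u, u1 <= u <= u2 & psi q u = 0.
  apply: ivt_zero; first by rewrite ltW // (lt_trans u10).
    by move=> u /uu[ue _]; apply: cpsi; have [] := box u v1 ue ve1.
  by near: q.
have [ue ue'] := uu u u12.
have [aneg npos] := box' u q ue' q1 q2.
have [v v12 phiv] : exists2 v, v1 <= v <= v2 & phi u v - tau (u, q) = 0.
  apply: (@ivt_zero _ (fun v => phi u v - tau (u, q))) => //.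
    by rewrite ltW // (lt_trans v10).
  move=> v /andP[vv1 vv2]; have ve : v0 - e < v < v0 + e.
    by rewrite (lt_le_trans v1e) // (le_lt_trans vv2).
  have [Iu Jv _ _] := box u v ue ve.
  by apply: cvgB; [exact: cphi_v|exact: cvg_cst].
have ve : v0 - e < v < v0 + e.
  by case/andP: v12 => vv1 vv2; rewrite (lt_le_trans v1e) // (le_lt_trans vv2).
have [Iu Jv Ouv N0] := box u v ue ve.
have := circleP Iu Jv; rewrite -/(y1 u v) -/(y2 u v) => C.
move: phiv npos N0; rewrite /phi /tau /nor /= => /eqP.
rewrite subr_eq0 => /eqP phiv npos N0.
move/eqP: psiu; rewrite /psi subr_eq0 => /eqP psiu.
suff [E1 E2] : y1 u v = q.1 - c1 u /\ y2 u v = q.2 - c2 u.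
  by exists u, v; split=> //; [apply: (addIr (- c1 u))|apply: (addIr (- c2 u))].
move: C phiv N0 npos psiu.
move: (y1 u v) (y2 u v) (q.1 - c1 u) (q.2 - c2 u) => a b k l C phiv N0 npos psiu.
have E : (s0 * a + t0 * b) ^+ 2 = (s0 * k + t0 * l) ^+ 2.
  have E x y : (s0 * x + t0 * y) ^+ 2 = (s0 ^+ 2 + t0 ^+ 2) * (x * x + y * y)
    - (s0 * y - t0 * x) ^+ 2 by ring.
  by rewrite !E phiv psiu -!expr2 C.
have n : s0 ^+ 2 + t0 ^+ 2 != 0 by rewrite nrm2 sqrf_eq0 gt_eqF.
have {}E : s0 * a + t0 * b = s0 * k + t0 * l.
  by apply/eqP; rewrite -(eqrXn2 (n := 2)) ?E // ltW.
split; apply: (mulfI n).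
  transitivity (s0 * (s0 * a + t0 * b) - t0 * (s0 * b - t0 * a)); first by ring.
  by rewrite E phiv; ring.
transitivity (t0 * (s0 * a + t0 * b) + s0 * (s0 * b - t0 * a)); first by ring.
by rewrite E phiv; ring.
Unshelve. all: by end_near. Qed.

End FlatOpen.

(** * Rotations about the vertical axis and their conjugates *)

Section Rotations.
Context {R : realType}.

Definition rotz (t : R) : 'M[R]_3 :=
  \matrix_i [:: vec3 (cos t) (sin t) 0; vec3 (- sin t) (cos t) 0; vec3 0 0 1]`_i.

Lemma mulmx_rotz (x : 'rV[R]_3) t : x *m rotz t =
  vec3 (x 0 0 * cos t - x 0 1 * sin t) (x 0 0 * sin t + x 0 1 * cos t) (x 0 2).
Proof.
by apply: row3P; rewrite mulmx3E /rotz /vec3 !mxE /= ?mxE /=; ring.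
Qed.

Lemma mx3P m (A B : 'M[R]_(m, 3)) : (forall x : 'rV_m, x *m A = x *m B) -> A = B.
Proof. by move=> AB; apply/row_matrixP => i; rewrite !rowE AB. Qed.

Lemma rotzD s t : rotz (s + t) = rotz s *m rotz t.
Proof.
apply: mx3P => x; rewrite mulmxA !mulmx_rotz !vec3E cosD sinD.
by congr vec3; ring.
Qed.

Lemma rotz_isometry t : lorentz_isometry (rotz t).
Proof.
move=> x y; rewrite !mulmx_rotz /lorentz !vec3E.
have := cos2Dsin2 t; move: (cos t) (sin t) => c s E.
transitivity ((x 0 0 * y 0 0 + x 0 1 * y 0 1) * (c ^+ 2 + s ^+ 2)
  - x 0 2 * y 0 2); first by ring.
by rewrite E mulr1.
Qed.

Lemma derivable_rotz i j t : derivable (fun t => rotz t i j) t 1.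
Proof.
have E (g : R -> R) : (forall s, g s = rotz s i j) -> derivable g t 1 ->
    derivable (fun t => rotz t i j) t 1.
  by move=> /funext ->.
have dc : derivable cos t 1 by exact: derivable_cos.
have ds : derivable sin t 1 by exact: derivable_sin.
have dN : derivable (fun t => - sin t) t 1 by exact: derivableN.
case: (ord3P i) E => ->; case: (ord3P j) => -> E;
  (apply: E; first by move=> s; rewrite /rotz /vec3 !mxE /= ?mxE);
  by [|exact: derivable_cst].
Qed.

Lemma derivable_mulmxl (F : R -> 'M[R]_3) (C : 'M[R]_3) t :
  (forall i j, derivable (fun t => F t i j) t 1) ->
  forall i j, derivable (fun t => (C *m F t) i j) t 1.
Proof.
move=> dF i j.
rewrite (_ : (fun s => _) = fun s =>
  C i 0 * F s 0 j + C i 1 * F s 1 j + C i 2 * F s 2 j); last first.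
  by apply/funext => s; rewrite mulmx3E.
by apply: derivableD; [apply: derivableD|]; apply: derivableM.
Qed.

Lemma derivable_mulmxr (F : R -> 'M[R]_3) (C : 'M[R]_3) t :
  (forall i j, derivable (fun t => F t i j) t 1) ->
  forall i j, derivable (fun t => (F t *m C) i j) t 1.
Proof.
move=> dF i j.
rewrite (_ : (fun s => _) = fun s =>
  F s i 0 * C 0 j + F s i 1 * C 1 j + F s i 2 * C 2 j); last first.
  by apply/funext => s; rewrite mulmx3E.
by apply: derivableD; [apply: derivableD|]; apply: derivableM.
Qed.

Lemma rotation_group_conj (B : 'M[R]_3) : B *m B = 1%:M -> lorentz_isometry B ->
  rotation_group (vec3 0 0 1 *m B) (fun t => B *m rotz t *m B).
Proof.
move=> BB isoB; split.
- move=> s t; rewrite rotzD -[in RHS]mulmxA (mulmxA B (B *m rotz t)).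
  by rewrite (mulmxA B B) BB mul1mx !mulmxA.
- move=> t; apply/derivable_mxP; apply: derivable_mulmxr; apply: derivable_mulmxl.
  by move=> i j; exact: derivable_rotz.
- exists pi; apply/eqP => E.
  have : vec3 1 0 0 *m B *m (B *m rotz pi *m B) = vec3 1 0 0 *m B.
    by rewrite E mulmx1.
  rewrite !mulmxA -(mulmxA (vec3 1 0 0) B B) BB mulmx1 => /(congr1 (mulmx^~ B)).
  rewrite -!mulmxA BB !mulmx1 mulmx_rotz cospi sinpi => /rowP/(_ 0).
  by rewrite !vec3E => /eqP; rewrite mulr0 subr0 mul1r => /eqP e; have := @ltrN10 R; rewrite e ltr10.
- by move=> t x y; rewrite !mulmxA isoB rotz_isometry isoB.
move=> t; rewrite !mulmxA -(mulmxA (vec3 0 0 1) B B) BB mulmx1 mulmx_rotz !vec3E.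
by congr (vec3 _ _ _ *m _); ring.
Qed.

End Rotations.

Section FlatSurfaces.
Context {R : realType} {M : topologicalType}.
Variables (f : M -> 'rV[R]_3) (A : set (chart R M)) (B : 'M[R]_3).
Hypotheses (isoB : lorentz_isometry B) (BB : B *m B = 1%:M).
Hypothesis surf : immersed_surface f A.
Variables (nu : 'rV[R]_3) (k r : R) (rad : M -> R).
Hypotheses (k0 : k != 0) (nuB : nu *m B = vec3 0 0 k) (r0 : 0 < r).
Hypothesis fol : foliated_by_circles f A nu rad.
Hypothesis radr : forall m, rad m = r.

Lemma flat_surface_open (m : M) (W : set M) (z : R) : nbhs m W ->
  (forall m, (f m *m B) 0 2 = z) ->
  \forall q \near ((f m *m B) 0 0, (f m *m B) 0 1), exists2 m', W m' &
    f m' *m B = vec3 q.1 q.2 z.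
Proof.
move=> nW flat.
have unitB : B \in unitmx by case/mulmx1_unit: BB.
have [phi [u [v [c [Aphi Iu Jv mE H]]]]] := foliated_chart isoB k0 nuB fol radr m.
case: (surf) => _ _ /(_ phi Aphi)[[oI _ oJ _] [cont _ _] sm _] _.
have jP := chart_jet_on B surf Aphi.
have regP s t (Is : chart_u phi s) (Jt : chart_v phi t) :=
  chart_jet_regular unitB surf Aphi Is Jt.
have hP s t : chart_u phi s -> chart_v phi t ->
    chart_jet f B phi [::] s t 0 2 = (fun=> z) s.
  by move=> _ _; exact: flat.
have cP s t (Is : chart_u phi s) (Jt : chart_v phi t) := (H s t Is Jt).2.
have [[a1 [b1 dc1]] [a2 [b2 dc2]]] :=
  twice_diff_centre oI oJ jP regP hP cP Jv.
have nO : nbhs (u, v) [set q : R * R | W (chart_map phi q.1 q.2)].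
  have Duv : (u, v) \in chart_dom phi by apply/mem_set.
  by move: nW; rewrite -mE => nW; exact: (cont (u, v) Duv _ nW).
have contP i : {for (u, v), continuous (fun q => chart_jet f B phi [::] q.1 q.2 0 i)}.
  have [+ _ _] := sm [::] (u, v) (conj Iu Jv); rewrite /= => cX.
  have cj j : (in_chart f phi q.1 q.2) 0 j @[q --> (u, v)] --> in_chart f phi u v 0 j.
    have := cvg_comp _ _ cX (@coord_continuous _ 1 3 0 j (in_chart f phi u v)).
    by [].
  rewrite /chart_jet /=.
  rewrite (_ : (fun q => _) = fun q : R * R =>
    in_chart f phi q.1 q.2 0 0 * B 0 i + in_chart f phi q.1 q.2 0 1 * B 1 i
    + in_chart f phi q.1 q.2 0 2 * B 2 i); last first.
    by apply/funext => q; rewrite mulmx3E.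
  by apply: cvgD; [apply: cvgD|]; apply: cvgM; [exact: cj|exact: cvg_cst
    |exact: cj|exact: cvg_cst|exact: cj|exact: cvg_cst].
have dz s : chart_u phi s -> is_derive s 1 (fun=> z) ((fun=> 0) s) /\
    is_derive s 1 (fun=> 0 : R) ((fun=> 0) s).
  by move=> _; split; exact: is_derive_cst.
have tr := flat_transverse oI oJ jP r0 regP hP cP dc1 dc2 dz Iu Jv erefl.
have ne := dv_neq0 oJ jP regP hP Iu Jv.
have ta := radius_v oJ jP cP Iu Jv.
have := flat_open oI oJ jP r0 Iu Jv nO cP (fun u Iu => (dc1 u Iu).1)
  (fun u Iu => (dc2 u Iu).1) contP tr ta ne.
rewrite /chart_jet /= /in_chart mE; apply: filterS.
move=> q [s [t [Is Jt /= Wst q1 q2]]]; exists (chart_map phi s t) => //.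
by apply: row3P; rewrite vec3E.
Qed.

(** The surface is open in its plane, so a small rotation about any axis normal to the plane keeps a
    point in the image of the given neighbourhood; the axis through the origin is taken. *)
Lemma flat_surface_rotational (z : R) :
  (forall m, (f m *m B) 0 2 = z) -> rotational f.
Proof.
move=> flat; exists 0, (vec3 0 0 1 *m B), (fun t => B *m rotz t *m B); split.
- apply/eqP => /(congr1 (mulmx^~ B)); rewrite -mulmxA BB mulmx1 mul0mx.
  by move=> /rowP/(_ 2); rewrite vec3E mxE => /eqP; rewrite oner_eq0.
- exact: rotation_group_conj.
move=> m W nW; have := flat_surface_open nW flat.
set x := f m *m B => nq.
have c : (x 0 0 * cos t - x 0 1 * sin t, x 0 0 * sin t + x 0 1 * cos t)
    @[t --> (0 : R)] --> (x 0 0, x 0 1).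
  have cc : cos t @[t --> (0 : R)] --> (1 : R).
    by rewrite -cos0; exact: continuous_cos.
  have cs : sin t @[t --> (0 : R)] --> (0 : R).
    by rewrite -[X in _ --> X]sin0; exact: continuous_sin.
  have c1 : x 0 0 * cos t - x 0 1 * sin t @[t --> (0 : R)]
      --> x 0 0 * 1 - x 0 1 * 0.
    by apply: cvgB; apply: cvgM => //; exact: cvg_cst.
  have c2 : x 0 0 * sin t + x 0 1 * cos t @[t --> (0 : R)]
      --> x 0 0 * 0 + x 0 1 * 1.
    by apply: cvgD; apply: cvgM => //; exact: cvg_cst.
  rewrite mulr1 mulr0 subr0 in c1; rewrite mulr1 mulr0 add0r in c2.
  exact: (@cvg_pair _ _ _ _ (nbhs (x 0 0)) (nbhs (x 0 1))).
near=> t.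
have [m' Wm' E] : exists2 m', W m' & f m' *m B =
    vec3 (x 0 0 * cos t - x 0 1 * sin t) (x 0 0 * sin t + x 0 1 * cos t) z.
  by near: t; exact: (c _ nq).
exists m' => //; rewrite subr0 add0r !mulmxA -/x mulmx_rotz.
rewrite (flat m : x 0 2 = z) -E -mulmxA BB mulmx1 //.
Unshelve. all: by end_near. Qed.

End FlatSurfaces.

(** * The cylinders with lightlike rulings *)

Lemma collinear_unit (R : realType) (e1 e2 y1 y2 : R) :
  e1 ^+ 2 + e2 ^+ 2 = 1 -> e1 * y2 - e2 * y1 = 0 ->
  let s := e1 * y1 + e2 * y2 in y1 = s * e1 /\ y2 = s * e2.
Proof.
move=> e_unit ey s; split.
  transitivity ((e1 ^+ 2 + e2 ^+ 2) * y1); first by rewrite e_unit mul1r.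
  transitivity (s * e1 - e2 * (e1 * y2 - e2 * y1)); first by rewrite /s; ring.
  by rewrite ey mulr0 subr0.
transitivity ((e1 ^+ 2 + e2 ^+ 2) * y2); first by rewrite e_unit mul1r.
transitivity (s * e2 + e1 * (e1 * y2 - e2 * y1)); first by rewrite /s; ring.
by rewrite ey mulr0 addr0.
Qed.

Section CylinderCausality.
Context {R : realType}.
Variables (r e1 e2 y1 y2 : R) (V : set 'rV[R]_3).
Hypotheses (r0 : 0 < r) (e_unit : e1 ^+ 2 + e2 ^+ 2 = 1).
Hypothesis y_norm : y1 ^+ 2 + y2 ^+ 2 = r ^+ 2.
Hypothesis V_ker : forall t, V t <->
  t 0 0 * y1 + t 0 1 * y2 + t 0 2 * - (e1 * y1 + e2 * y2) = 0.

(** When y = s e the equation of [V] is s times orthogonality to the ruling direction (e1, e2, 1),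
    which itself lies in [V]. *)
Lemma cylinder_degenerate : e1 * y2 - e2 * y1 = 0 -> degenerate V.
Proof.
move=> ey; pose s := e1 * y1 + e2 * y2.
have [E1 E2] : y1 = s * e1 /\ y2 = s * e2 by exact: collinear_unit.
have s0 : s != 0.
  apply/negP => /eqP s0; move/eqP: y_norm.
  by rewrite E1 E2 s0 !mul0r expr0n addr0 eq_sym sqrf_eq0 gt_eqF.
exists (vec3 e1 e2 1); split.
- by apply/V_ker; rewrite !vec3E; ring.
- apply/eqP => /rowP/(_ 2); rewrite vec3E mxE => /eqP; rewrite oner_eq0 //.
move=> t /V_ker; rewrite -/s E1 E2 /lorentz !vec3E => E.
by apply: (mulfI s0); rewrite mulr0 -[RHS]E; ring.
Qed.

Lemma cylinder_timelike : e1 * y2 - e2 * y1 != 0 -> timelike V.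
Proof.
move=> ey; have r2 : r ^+ 2 != 0 by rewrite expf_neq0 ?gt_eqF.
(* Gram-Schmidt coefficient making the ruling direction orthogonal to the circle direction. As the
   ruling is lightlike, the corrected vector has square - k^2 r^2. *)
pose k := (e1 * y2 - e2 * y1) / r ^+ 2.
exists (vec3 e1 e2 1 + k *: vec3 (- y2) y1 0), (vec3 (- y2) y1 0).
have yy : y1 * y1 = r ^+ 2 - y2 * y2 by rewrite -y_norm; ring.
have ee : e1 * e1 = 1 - e2 * e2 by rewrite -e_unit; ring.
have L : lorentz (vec3 e1 e2 1) (vec3 (- y2) y1 0) = - (k * r ^+ 2).
  by rewrite /lorentz !vec3E /k divfK //; ring.
have G : lorentz (vec3 (- y2) y1 0) (vec3 (- y2) y1 0) = r ^+ 2.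
  by rewrite /lorentz !vec3E -y_norm; ring.
have N : lorentz (vec3 e1 e2 1) (vec3 e1 e2 1) = 0.
  by rewrite /lorentz !vec3E ee; ring.
split.
- by apply/V_ker; rewrite !mxE /=; ring.
- by apply/V_ker; rewrite !vec3E; ring.
- by rewrite lorentzDl lorentzZl L G; ring.
- rewrite lorentzDl !lorentzDr !lorentzZl !lorentzZr (lorentzC (vec3 (- y2) _ _)).
  rewrite L G N (_ : _ + _ = - (k ^+ 2 * r ^+ 2)); last by ring.
  have k0 : k != 0 by rewrite mulf_neq0 // invr_eq0.
  by rewrite oppr_lt0; apply: mulr_gt0; [rewrite exprn_even_gt0|rewrite exprn_gt0].
- by rewrite G exprn_gt0.
Qed.

End CylinderCausality.

(** * The explicit parametrization and its two lightlike lines *)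

Section AffineTrig.
Context {R : realType}.
Implicit Types (p q : 'rV[R]_3).

(** A family closed under both partial derivatives: all iterated derivatives of [riemannX] belong to
    it, so smoothness needs only continuity and one derivative. *)
Definition affine_trig p q1 q2 q3 (u v : R) : 'rV[R]_3 :=
  u *: p + (cos v *: q1 + sin v *: q2) + q3.

Lemma is_derive_scale (f : R -> R) (x d : R) p :
  is_derive x 1 f d -> is_derive x 1 (fun t => f t *: p) (d *: p).
Proof.
move=> [/derivable1_diffP df <-]; have dfp := differentiableZl p df.
by apply: DeriveDef; [exact/derivable1_diffP|rewrite deriveE // diffZl // deriveE].
Qed.

Lemma affine_trig_u p q1 q2 q3 (u v : R) :
  is_derive u 1 ((affine_trig p q1 q2 q3)^~ v) p.
Proof.
have d1 := is_derive_scale p (is_derive_id u 1).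
have := is_deriveD (is_deriveD d1 (is_derive_cst (cos v *: q1 + sin v *: q2) u 1))
  (is_derive_cst q3 u 1).
by rewrite scale1r !addr0.
Qed.

Lemma affine_trig_v p q1 q2 q3 (u v : R) :
  is_derive v 1 (affine_trig p q1 q2 q3 u) (- sin v *: q1 + cos v *: q2).
Proof.
have d1 := is_derive_scale q1 (is_derive_cos v).
have d2 := is_derive_scale q2 (is_derive_sin v).
have := is_deriveD (is_deriveD (is_derive_cst (u *: p) v 1) (is_deriveD d1 d2))
  (is_derive_cst q3 v 1).
by rewrite addr0 add0r.
Qed.

Lemma du_affine_trig p q1 q2 q3 :
  du (affine_trig p q1 q2 q3) = affine_trig 0 0 0 p.
Proof.
apply/funext => u; apply/funext => v; rewrite /du derive1E.
have [_ ->] := affine_trig_u p q1 q2 q3 u v.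
by rewrite /affine_trig !scaler0 !add0r.
Qed.

Lemma dv_affine_trig p q1 q2 q3 :
  dv (affine_trig p q1 q2 q3) = affine_trig 0 q2 (- q1) 0.
Proof.
apply/funext => u; apply/funext => v; rewrite /dv derive1E.
have [_ ->] := affine_trig_v p q1 q2 q3 u v.
by rewrite /affine_trig !scaler0 !add0r addr0 addrC scaleNr scalerN.
Qed.

Lemma smooth_affine_trig p q1 q2 q3 (O : set (R * R)) :
  smooth_on O (affine_trig p q1 q2 q3).
Proof.
move=> w q _.
have [p' [q1' [q2' [q3' ->]]]] : exists p' q1' q2' q3',
    partial w (affine_trig p q1 q2 q3) = affine_trig p' q1' q2' q3'.
  elim: w => [|b w [p' [q1' [q2' [q3' IH]]]]]; first by exists p, q1, q2, q3.
  rewrite /= -/(partial w _) IH; case: b; rewrite ?du_affine_trig ?dv_affine_trig.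
    by exists 0, 0, 0, p'.
  by exists 0, q2', (- q1'), 0.
split; last 2 first.
- by case: (affine_trig_u p' q1' q2' q3' q.1 q.2).
- by case: (affine_trig_v p' q1' q2' q3' q.1 q.2).
rewrite /affine_trig.
apply: cvgD; last exact: cvg_cst.
have cs (g : R -> R) : continuous g -> g q'.2 @[q' --> q] --> g q.2.
  by move=> cg; apply: (@cvg_comp _ _ _ snd g _ (nbhs q.2)); [exact: cvg_snd|exact: cg].
apply: cvgD; last apply: cvgD.
- by apply: cvgZ; [exact: cvg_fst|exact: cvg_cst].
- by apply: cvgZ; [apply: cs; exact: continuous_cos|exact: cvg_cst].
- by apply: cvgZ; [apply: cs; exact: continuous_sin|exact: cvg_cst].
Qed.

End AffineTrig.

Section RiemannExamples.
Context {R : realType}.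
Variables (a : 'rV[R]_2) (r : R).
Hypothesis r0 : 0 < r.

Let e1 := - r ^+ 2 * a 0 0.
Let e2 := - r ^+ 2 * a 0 1.

Lemma riemannXE : riemannX a r =
  affine_trig (vec3 e1 e2 1) (vec3 r 0 0) (vec3 0 r 0) 0.
Proof.
apply/funext => z; apply/funext => v.
by apply: row3P; rewrite /riemannX /affine_trig /vec3 !mxE /= /e1 /e2; ring.
Qed.

Lemma riemannX_partials z v :
  [/\ du (riemannX a r) z v = vec3 e1 e2 1,
      dv (riemannX a r) z v = vec3 (- r * sin v) (r * cos v) 0,
      du (du (riemannX a r)) z v = 0, du (dv (riemannX a r)) z v = 0 &
      dv (dv (riemannX a r)) z v = vec3 (- r * cos v) (- r * sin v) 0].
Proof.
rewrite riemannXE !(du_affine_trig, dv_affine_trig).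
by split; apply: row3P; rewrite /affine_trig /vec3 !mxE /=; ring.
Qed.

Lemma riemannX_smooth O : smooth_on O (riemannX a r).
Proof. by rewrite riemannXE; exact: smooth_affine_trig. Qed.

Lemma riemannX_regular z v : regular_at (riemannX a r) z v.
Proof.
rewrite /regular_at; have [-> -> _ _ _] := riemannX_partials z v.
apply: pair_row_free => k l /rowP E.
have k0 : k = 0 by have := E 2; rewrite /vec3 !mxE /=; lra.
split=> //; have := E 0; have := E 1; rewrite k0 /vec3 !mxE /= => E1 E2.
have := cos2Dsin2 v => cs; apply: (mulfI (lt0r_neq0 r0)).
rewrite mulr0 -[LHS]mulr1 -cs.
transitivity (cos v * (l * (r * cos v)) - sin v * (l * (- r * sin v))); first by ring.
by move: E1 E2; rewrite !mul0r !add0r => -> ->; ring.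
Qed.

Lemma riemannX_cylinder z v : cylinder r e1 e2 0 0 (riemannX a r z v).
Proof.
rewrite /cylinder /riemannX /= /vec3 !mxE /= -/e1 -/e2.
transitivity (r ^+ 2 * (cos v ^+ 2 + sin v ^+ 2)); first by ring.
by rewrite cos2Dsin2 mulr1.
Qed.

Lemma polar_angle y1 y2 : y1 ^+ 2 + y2 ^+ 2 = r ^+ 2 ->
  exists v, y1 = r * cos v /\ y2 = r * sin v.
Proof.
move=> yr; have rn0 : r != 0 by rewrite gt_eqF.
have cr : y1 = r * (y1 / r) by rewrite mulrC divfK.
have sr : y2 = r * (y2 / r) by rewrite mulrC divfK.
have cs : (y1 / r) ^+ 2 + (y2 / r) ^+ 2 = 1.
  by rewrite !exprMn -mulrDl yr -exprMn mulfV // expr1n.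
move: cr sr cs; move: (y1 / r) (y2 / r) => c s cr sr cs.
have bd : -1 <= c <= 1 by apply/andP; split; nra.
have sa : sin (acos c) = `|s|.
  have E : 1 - c ^+ 2 = s ^+ 2 by rewrite -cs; ring.
  by rewrite sin_acos // E sqrtr_sqr.
have ca : cos (acos c) = c by rewrite acosK.
have [s0|s0] := leP 0 s.
  by exists (acos c); rewrite ca sa ger0_norm.
by exists (- acos c); rewrite cosN sinN ca sa ltr0_norm // opprK.
Qed.

Lemma cylinder_riemannX x : cylinder r e1 e2 0 0 x ->
  exists z v, x = riemannX a r z v.
Proof.
rewrite /cylinder /= !subr0 => /polar_angle[v [h1 h2]]; exists (x 0 2), v.
rewrite riemannXE.
by apply: row3P; rewrite /affine_trig /vec3 !mxE /= -/e1 -/e2;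
  [rewrite -[LHS](subrK (x 0 2 * e1)) h1|rewrite -[LHS](subrK (x 0 2 * e2)) h2|];
  ring.
Qed.

Hypothesis e_unit : e1 ^+ 2 + e2 ^+ 2 = 1.

(** The line of direction (e, 1) through the point s e of the plane x_3 = 0. For s = r and s = - r
    it lies on the cylinder, over the two points where y is parallel to e. *)
Definition ruling (s : R) : set 'rV[R]_3 :=
  [set s *: vec3 e1 e2 0 + t *: vec3 e1 e2 1 | t in setT].

Lemma ruling_lightlike s : lightlike_line (ruling s).
Proof.
exists (s *: vec3 e1 e2 0), (vec3 e1 e2 1); split=> //.
  by apply/eqP => /rowP/(_ 2); rewrite vec3E mxE => /eqP; rewrite oner_eq0.
by rewrite /lorentz !vec3E -!expr2 e_unit expr1n subrr.
Qed.

Let on_rulings := ruling r `|` ruling (- r).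

Lemma ruling_cylinder s x : s ^+ 2 = r ^+ 2 -> ruling s x ->
  cylinder r e1 e2 0 0 x /\
  e1 * (x 0 1 - 0 - x 0 2 * e2) - e2 * (x 0 0 - 0 - x 0 2 * e1) = 0.
Proof.
move=> sr [t _ <-]; rewrite /cylinder /= /vec3 !mxE /=; split; last by ring.
by transitivity (s ^+ 2 * (e1 ^+ 2 + e2 ^+ 2)); [ring|rewrite e_unit mulr1].
Qed.

Lemma on_rulingsE x : cylinder r e1 e2 0 0 x -> on_rulings x <->
  e1 * (x 0 1 - 0 - x 0 2 * e2) - e2 * (x 0 0 - 0 - x 0 2 * e1) = 0.
Proof.
move=> cx; split; first by case=> /ruling_cylinder[]//; rewrite sqrrN.
move=> ey; have := cx; rewrite /cylinder /=.
set y1 := x 0 0 - 0 - _ in ey *; set y2 := x 0 1 - 0 - _ in ey * => yr.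
pose s := e1 * y1 + e2 * y2.
have [E1 E2] : y1 = s * e1 /\ y2 = s * e2 by exact: collinear_unit.
have Hs : ruling s x.
  exists (x 0 2) => //; apply: row3P; rewrite /vec3 !mxE /=.
  - by rewrite -E1 /y1; ring.
  - by rewrite -E2 /y2; ring.
  - by ring.
have : s ^+ 2 == r ^+ 2.
  apply/eqP; rewrite -yr E1 E2 -[LHS]mulr1.
  by transitivity (s ^+ 2 * (e1 ^+ 2 + e2 ^+ 2)); [rewrite e_unit|ring].
by rewrite eqf_sqr => /orP[] /eqP sr; [left|right]; rewrite -sr.
Qed.

(** [V] is known only by its equation, so the lemma serves both the explicit parametrization and an
    arbitrary surface on the cylinder. *)
Lemma cylinder_causal (x : 'rV[R]_3) (V : set 'rV[R]_3) :
  let y1 := x 0 0 - 0 - x 0 2 * e1 in let y2 := x 0 1 - 0 - x 0 2 * e2 in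
  cylinder r e1 e2 0 0 x ->
  (forall t, V t <-> t 0 0 * y1 + t 0 1 * y2 + t 0 2 * - (e1 * y1 + e2 * y2) = 0) ->
  (on_rulings x -> degenerate V) /\ (~ on_rulings x -> timelike V).
Proof.
move=> y1 y2 cx Vk; split.
  by move/(on_rulingsE cx) => ey; exact: cylinder_degenerate r0 e_unit cx Vk ey.
move=> nL; apply: (cylinder_timelike r0 e_unit cx Vk).
by apply/eqP => ey; apply: nL; apply/(on_rulingsE cx).
Qed.

Lemma riemannX_extended :
  timelike_extended_to_lines (riemannX a r) (ruling r) (ruling (- r)).
Proof.
split; [exact: ruling_lightlike|exact: ruling_lightlike| |split].
- rewrite -subset0 => x [[s _ sx] [t _ tx]].
  move: sx; rewrite -tx => /rowP E.
  have := E 2; have := E 0; have := E 1; rewrite /vec3 !mxE /= => h1 h0 h2.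
  have st : s = t by lra.
  have f1 : (2 * r) * e1 = 0 by rewrite st in h0; lra.
  have f2 : (2 * r) * e2 = 0 by rewrite st in h1; lra.
  have r2 : 2 * r != 0 by rewrite mulf_neq0 ?pnatr_eq0 ?gt_eqF.
  have z1 : e1 = 0 by apply: (mulfI r2); rewrite mulr0.
  have z2 : e2 = 0 by apply: (mulfI r2); rewrite mulr0.
  by move/eqP: e_unit; rewrite z1 z2 expr0n addr0 eq_sym oner_eq0.
- exact: riemannX_smooth.
- exact: riemannX_regular.
- move=> x Lx; have cx : cylinder r e1 e2 0 0 x.
    by case: Lx => /ruling_cylinder[]//; rewrite sqrrN.
  by have [z [v ->]] := cylinder_riemannX cx; exists (z, v).
move=> z v; apply: cylinder_causal; first exact: riemannX_cylinder.
have jX : jet_on setT setT (fun w u v => partial w (riemannX a r) u v).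
  by apply: smooth_jet; exact: riemannX_smooth.
move=> t; have := @cylinder_tangent _ _ _ _ jX setT openT (fun _ _ _ => conj I I)
  r e1 e2 0 0 (fun z v _ => riemannX_cylinder z v) r0
  (fun z v _ => riemannX_regular z v) z v t I.
by [].
Qed.

End RiemannExamples.

(** * Normal form of the planes *)

Section NormalForm.
Context {R : realType}.
Implicit Types (nu d x : 'rV[R]_3).

Lemma spacelike_orthogonal_timelike nu :
  spacelike (orthogonal_plane nu) -> lorentz nu nu < 0.
Proof.
move=> sp; rewrite ltNge; apply/negP => nn.
pose s := nu 0 0 ^+ 2 + nu 0 1 ^+ 2.
have ns : lorentz nu nu = s - nu 0 2 ^+ 2 by rewrite /lorentz /s; ring.
have s_ge0 : 0 <= s by rewrite addr_ge0 ?sqr_ge0.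
(* In this case nu = 0, and the timelike vertical vector is orthogonal to it. *)
have [s0|s0] := eqVneq s 0.
  have n2 : nu 0 2 = 0.
    apply/eqP; rewrite -sqrf_eq0 eq_le sqr_ge0 andbT.
    by move: nn; rewrite ns s0; lra.
  have := sp (vec3 0 0 1); rewrite /orthogonal_plane /= /lorentz !vec3E n2.
  have v0 : vec3 0 0 1 != 0 :> 'rV[R]_3.
    by apply/eqP => /rowP/(_ 2); rewrite vec3E mxE => /eqP; rewrite oner_eq0.
  have o : 0 * nu 0 0 + 0 * nu 0 1 - 1 * 0 = 0 :> R by ring.
  by move=> /(_ o v0); lra.
(* A vector orthogonal to nu whose square is - s <nu, nu>, which is not positive if nu is not
   timelike. *)
have := sp (vec3 (nu 0 2 * nu 0 0) (nu 0 2 * nu 0 1) s).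
rewrite /orthogonal_plane /= /lorentz !vec3E.
have o : nu 0 2 * nu 0 0 * nu 0 0 + nu 0 2 * nu 0 1 * nu 0 1 - s * nu 0 2 = 0.
  by rewrite /s; ring.
have v0 : vec3 (nu 0 2 * nu 0 0) (nu 0 2 * nu 0 1) s != 0.
  by apply/eqP => /rowP/(_ 2); rewrite vec3E mxE => /eqP; rewrite (negbTE s0).
move=> /(_ o v0); rewrite (_ : _ - _ = - (s * (s - nu 0 2 ^+ 2))); last by rewrite /s; ring.
by rewrite oppr_gt0 ltNge mulr_ge0 // -ns.
Qed.

(** The reflection in the plane orthogonal to [d], acting on row vectors; the column is the metric
    dual of [d]. *)
Definition lorentz_reflection d : 'M[R]_3 :=
  1%:M - (2 / lorentz d d) *: ((\col_i [:: d 0 0; d 0 1; - d 0 2]`_i) *m d).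

Lemma mulmx_reflection d x :
  x *m lorentz_reflection d = x + (- (2 * lorentz x d / lorentz d d)) *: d.
Proof.
rewrite /lorentz_reflection mulmxBr mulmx1 -scalemxAr mulmxA mulmx_col3.
rewrite mul_scalar_mx scalerA scaleNr; congr (_ - _ *: _).
by rewrite {2}/lorentz; ring.
Qed.

Lemma reflection_isometry d : lorentz d d != 0 ->
  lorentz_isometry (lorentz_reflection d).
Proof.
move=> dd x y; rewrite !mulmx_reflection.
rewrite !lorentzDl !lorentzDr !lorentzZl !lorentzZr (lorentzC d y).
by field.
Qed.

Lemma reflection_involution d : lorentz d d != 0 ->
  lorentz_reflection d *m lorentz_reflection d = 1%:M.
Proof.
move=> dd; apply: mx3P => x; rewrite mulmxA mulmx1 !mulmx_reflection.
rewrite lorentzDl lorentzZl -addrA -scalerDl [X in X *: d](_ : _ = 0).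
  by rewrite scale0r addr0.
by field.
Qed.

Lemma timelike_vertical nu : lorentz nu nu < 0 -> exists (B : 'M[R]_3) k,
  [/\ k != 0, lorentz_isometry B, B *m B = 1%:M & nu *m B = vec3 0 0 k].
Proof.
move=> nn; pose q := - lorentz nu nu; have q0 : 0 < q by rewrite oppr_gt0.
(* The reflection along nu - (0, 0, k) exchanges the two vectors when their squares agree, hence k^2
   = q. The sign of k is chosen so that <d, d> is negative. *)
have [k kq kn] : exists2 k, k ^+ 2 = q & k * nu 0 2 <= 0.
  have sq : Num.sqrt q ^+ 2 = q by rewrite sqr_sqrtr // ltW.
  have [n0|n0] := leP (nu 0 2) 0.
    by exists (Num.sqrt q) => //; rewrite mulr_ge0_le0 // sqrtr_ge0.
  by exists (- Num.sqrt q); rewrite ?sqrrN // mulNr oppr_le0 mulr_ge0 // ?sqrtr_ge0 // ltW.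
have k0 : k != 0 by rewrite -sqrf_eq0 kq gt_eqF.
pose d := nu - vec3 0 0 k.
have dn : lorentz nu d = k * nu 0 2 - q.
  by rewrite /d /q /lorentz /vec3 !mxE /=; ring.
have dd : lorentz d d = 2 * (k * nu 0 2 - q).
  have -> : 2 * (k * nu 0 2 - q) = - q + 2 * (k * nu 0 2) - k ^+ 2.
    by rewrite kq; ring.
  by rewrite /d /q /lorentz /vec3 !mxE /=; ring.
have c0 : k * nu 0 2 - q != 0 by rewrite lt_eqF // subr_lt0 (le_lt_trans kn).
have dd0 : lorentz d d != 0 by rewrite dd mulf_neq0 ?pnatr_eq0.
exists (lorentz_reflection d), k; split=> //.
- exact: reflection_isometry.
- exact: reflection_involution.
rewrite mulmx_reflection dn dd divff ?mulf_neq0 ?pnatr_eq0 //.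
by rewrite scaleN1r /d opprB addrCA subrr addr0.
Qed.

Lemma degenerate_mul x y (B : 'M[R]_3) : lorentz_isometry B ->
  degenerate (span2 (x *m B) (y *m B)) -> degenerate (span2 x y).
Proof.
move=> isoB [_ [[a _ [b _ <-]] nz orth]].
rewrite !scalemxAl -mulmxDl in nz orth.
exists (a *: x + b *: y); split; first by exists a => //; exists b.
  by apply: contraNneq nz => ->; rewrite mul0mx.
move=> _ [a' _ [b' _ <-]]; rewrite -isoB; apply: orth.
by exists a' => //; exists b'; rewrite // !scalemxAl -mulmxDl.
Qed.

Lemma timelike_mul x y (B : 'M[R]_3) : lorentz_isometry B ->
  timelike (span2 (x *m B) (y *m B)) -> timelike (span2 x y).
Proof.
move=> isoB [_ [_ [[a _ [b _ <-]] [a' _ [b' _ <-]]]]].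
rewrite !scalemxAl -!mulmxDl !isoB => ? ? ?.
exists (a *: x + b *: y), (a' *: x + b' *: y); split=> //.
  by exists a => //; exists b.
by exists a' => //; exists b'.
Qed.

End NormalForm.

(** * Classification up to rigid motion *)

Section Classification.
Context {R : realType} {M : topologicalType}.
Variables (f : M -> 'rV[R]_3) (A : set (chart R M)) (nu : 'rV[R]_3)
  (rad : M -> R) (r : R).
Hypotheses (r0 : 0 < r) (sp : spacelike (orthogonal_plane nu)).
Hypothesis ex : riemann_zmc_example f A nu rad.
Hypothesis radr : forall m, rad m = r.

Lemma cylinder_classification : exists (B : 'M[R]_3) (e1 e2 d1 d2 : R),
  [/\ lorentz_isometry B, B \in unitmx, e1 ^+ 2 + e2 ^+ 2 = 1 &
    forall m, cylinder r e1 e2 d1 d2 (f m *m B)].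
Proof.
have [surf nrot zmc fol] := ex.
have [B [k [k0 isoB BB nuB]]] := timelike_vertical (spacelike_orthogonal_timelike sp).
have unitB : B \in unitmx by case/mulmx1_unit: BB.
have nflat z : ~ (forall m, (f m *m B) 0 2 = z).
  move=> flat; apply: nrot.
  by have := flat_surface_rotational isoB BB surf k0 nuB r0 fol radr flat.
(* An empty surface would be vacuously flat, so [nflat] also provides a point. *)
have [[m0 _]|noM] := pselect (exists m : M, True); last first.
  by case: (nflat 0) => m; case: noM; exists m.
have [t Ht] := global_piece isoB unitB surf k0 nuB r0 zmc fol radr m0.
case: t Ht => [z|[[[e1 e2] d1] d2]] Ht; first by case: (nflat z).
have [e _] := Ht m0; exists B, e1, e2, d1, d2; split=> // m.
by have [] := Ht m.
Qed.

Lemma riemann_zmc_classification :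
  exists (a : 'rV[R]_2) (Phi : 'rV[R]_3 -> 'rV[R]_3) (L1 L2 : set 'rV[R]_3),
    [/\ a != 0, rigid_motion Phi,
        forall m, exists z v, Phi (f m) = riemannX a r z v,
        timelike_extended_to_lines (riemannX a r) L1 L2 &
        forall phi u v, A phi -> chart_dom phi (u, v) ->
          ((L1 `|` L2) (Phi (in_chart f phi u v)) ->
             degenerate (tangent (in_chart f phi) u v)) /\
          (~ (L1 `|` L2) (Phi (in_chart f phi u v)) ->
             timelike (tangent (in_chart f phi) u v))].
Proof.
have [B [e1 [e2 [d1 [d2 [isoB unitB e_unit cyl]]]]]] := cylinder_classification.
have [surf _ _ _] := ex.
(* Solves e = - r^2 a; the horizontal translation in [Phi] then centres the cylinder. *)
pose a : 'rV[R]_2 := \row_i [:: - e1 / r ^+ 2; - e2 / r ^+ 2]`_i.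
have r2 : r ^+ 2 != 0 by rewrite expf_neq0 ?gt_eqF.
have a1 : - r ^+ 2 * a 0 0 = e1 by rewrite mxE /=; field; rewrite gt_eqF.
have a2 : - r ^+ 2 * a 0 1 = e2 by rewrite mxE /=; field; rewrite gt_eqF.
pose Phi x := x *m B + vec3 (- d1) (- d2) 0.
have au : (- r ^+ 2 * a 0 0) ^+ 2 + (- r ^+ 2 * a 0 1) ^+ 2 = 1 by rewrite a1 a2.
have Phi0 x : Phi x 0 0 = (x *m B) 0 0 - d1 by rewrite mxE vec3E.
have Phi1 x : Phi x 0 1 = (x *m B) 0 1 - d2 by rewrite mxE vec3E.
have Phi2 x : Phi x 0 2 = (x *m B) 0 2 by rewrite mxE vec3E addr0.
have cylPhi m : cylinder r (- r ^+ 2 * a 0 0) (- r ^+ 2 * a 0 1) 0 0 (Phi (f m)).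
  by rewrite a1 a2 /cylinder /= Phi0 Phi1 Phi2 !subr0; exact: cyl.
exists a, Phi, (ruling a r r), (ruling a r (- r)); split.
- apply/eqP => a0; move/eqP: e_unit.
  by rewrite -a1 -a2 a0 !mxE !mulr0 expr0n addr0 eq_sym oner_eq0.
- by exists B, (vec3 (- d1) (- d2) 0).
- by move=> m; exact: cylinder_riemannX r0 _ (cylPhi m).
- exact: riemannX_extended.
move=> phi u v Aphi [/= Iu Jv].
have [oI oJ] : open (chart_u phi) /\ open (chart_v phi).
  by case: surf => _ _ /(_ phi Aphi)[[? _ ? _] _ _ _] _.
have T := @cylinder_tangent _ _ _ _ (chart_jet_on B surf Aphi)
  (chart_u phi `*` chart_v phi) (open_setX oI oJ) (fun _ _ => id)
  r e1 e2 d1 d2 (fun s t _ => cyl (chart_map phi s t)) r0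
  (fun s t D => chart_jet_regular unitB surf Aphi D.1 D.2) u v.
have := @cylinder_causal _ a r r0 au (Phi (in_chart f phi u v))
  (span2 (chart_jet f B phi [:: true] u v) (chart_jet f B phi [:: false] u v))
  (cylPhi (chart_map phi u v)).
rewrite Phi0 Phi1 Phi2 a1 a2 !subr0 => /(_ (fun t => T t (conj Iu Jv)))[deg tim].
split; first by move=> /deg; exact: degenerate_mul.
by move=> /tim; exact: timelike_mul.
Qed.

End Classification.

(** * The examples are not rotational *)

Section RotationGenerator.
Context {R : realType}.
Implicit Types (x y : 'rV[R]_3) (B : 'M[R]_3).

Lemma isometry_inj B x : lorentz_isometry B -> x *m B = 0 -> x = 0.
Proof.
move=> isoB xB.
have H y : lorentz x y = 0 by rewrite -isoB xB /lorentz !mxE; ring.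
apply: row3P; rewrite mxE.
- by have := H (vec3 1 0 0); rewrite /lorentz !vec3E => <-; ring.
- by have := H (vec3 0 1 0); rewrite /lorentz !vec3E => <-; ring.
- by have := H (vec3 0 0 (-1)); rewrite /lorentz !vec3E => <-; ring.
Qed.

Variables (d : 'rV[R]_3) (G : R -> 'M[R]_3).
Hypothesis rotG : rotation_group d G.

Let K : 'M[R]_3 := \matrix_(i, j) 'D_1 (fun t => G t i j) 0.

(** The group law makes [G 0] idempotent, and an isometry is injective. *)
Lemma rotation_group0 : G 0 = 1%:M.
Proof.
case: rotG => mor _ _ iso _.
apply: mx3P => x; rewrite mulmx1; apply/eqP; rewrite -subr_eq0; apply/eqP.
apply: (isometry_inj (iso 0)).
by rewrite mulmxBl -mulmxA -mor addr0 subrr.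
Qed.

Lemma is_derive_generator i j : is_derive (0 : R) 1 (fun t => G t i j) (K i j).
Proof.
rewrite mxE; apply: derivableP.
by case: rotG => _ /(_ 0)/derivable_mxP.
Qed.

Lemma is_derive_orbit x j : is_derive (0 : R) 1 (fun t => (x *m G t) 0 j) ((x *m K) 0 j).
Proof.
rewrite mulmx3E (_ : (fun t => _) = fun t =>
  x 0 0 * G t 0 j + x 0 1 * G t 1 j + x 0 2 * G t 2 j); last first.
  by apply/funext => t; rewrite mulmx3E.
have e i : is_derive (0 : R) 1 (fun t => x 0 i * G t i j) (x 0 i * K i j).
  have := is_deriveMf (is_derive_cst (x 0 i) (0 : R) 1) (is_derive_generator i j).
  by rewrite mulr0 addr0.
by do 2?apply: is_deriveDf; exact: e.
Qed.

Lemma generator_skew x y : lorentz (x *m K) y + lorentz x (y *m K) = 0.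
Proof.
case: rotG => _ _ _ iso _.
have e i := is_deriveMf (is_derive_orbit x i) (is_derive_orbit y i).
have := is_derive_near_cst (is_deriveBf (is_deriveDf (e 0) (e 1)) (e 2)).
rewrite rotation_group0 !mulmx1 => /(_ (lorentz x y)) H; rewrite -[RHS]H.
  by rewrite /lorentz; ring.
by apply: filterE => t; rewrite -(iso t x y).
Qed.

(** Since [G t] is the product of [G s] and [G (t - s)], a zero derivative at 0 propagates to every
    s, and the group would be trivial. *)
Lemma generator_neq0 : K != 0.
Proof.
apply/eqP => K0; case: rotG => mor _ [t /eqP Gt] _ _; apply: Gt.
rewrite -rotation_group0; apply/matrixP => i j.
apply: (@is_derive_0_is_cst _ (fun t => G t i j)) => s.
have -> : (fun t => G t i j) = (fun t => (row i (G s) *m G t) 0 j) \o (fun t => t - s).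
  apply/funext => q /=.
  by rewrite -row_mul -mor addrC subrK mxE.
have := @is_derive1_comp _ (fun t => (row i (G s) *m G t) 0 j) (fun t => t - s) s
  0 1.
rewrite mul0r subrr; apply.
  by have := is_derive_orbit (row i (G s)) j; rewrite K0 mulmx0 mxE.
by have := is_deriveBf (is_derive_id s 1) (is_derive_cst s s 1); rewrite subr0.
Qed.

End RotationGenerator.

Section NotRotational.
Context {R : realType}.
Variables (a : 'rV[R]_2) (r : R).
Hypothesis r0 : 0 < r.
Let e1 := - r ^+ 2 * a 0 0.
Let e2 := - r ^+ 2 * a 0 1.
Hypothesis e_unit : e1 ^+ 2 + e2 ^+ 2 = 1.

(** For small times the orbit of a surface point stays on the cylinder, so its initial velocity is
    tangent. The whole parameter plane serves as the neighbourhood. *)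
Lemma rotational_cylinder_generator (p : 'rV[R]_3) (d : 'rV[R]_3) G :
  rotation_group d G ->
  (forall (m : R * R) (W : set (R * R)), nbhs m W -> \forall t \near (0 : R),
    ((fun q : R * R => riemannX a r q.1 q.2) @` W)
      (p + (riemannX a r m.1 m.2 - p) *m G t)) ->
  exists K : 'M[R]_3, [/\ K != 0,
    forall x y, lorentz (x *m K) y + lorentz x (y *m K) = 0 &
    forall z c s, c ^+ 2 + s ^+ 2 = 1 ->
      let x := z *: vec3 e1 e2 1 + r *: vec3 c s 0 in let w := (x - p) *m K in
      c * (w 0 0 - w 0 2 * e1) + s * (w 0 1 - w 0 2 * e2) = 0].
Proof.
move=> rotG inv; pose K : 'M[R]_3 := \matrix_(i, j) 'D_1 (fun t => G t i j) 0.
exists K; split; [exact: generator_neq0 rotG|exact: generator_skew rotG|].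
move=> z c s cs x w.
have [v [cE sE]] : exists v, c = 1 * cos v /\ s = 1 * sin v.
  by apply: polar_angle; rewrite ?ltr01 // expr1n.
rewrite !mul1r in cE sE.
have xE : x = riemannX a r z v by rewrite /x cE sE.
have G0 := rotation_group0 rotG.
pose Y t := p + (x - p) *m G t.
have dY j : is_derive (0 : R) 1 (fun t => Y t 0 j) (w 0 j).
  have := is_deriveDf (is_derive_cst (p 0 j) (0 : R) 1) (is_derive_orbit rotG (x - p) j).
  rewrite add0r (_ : (fun t => _) = fun t => Y t 0 j) //.
  by apply/funext => t; rewrite /Y [RHS]mxE.
have Y0 : Y 0 = x by rewrite /Y G0 mulmx1 addrC subrK.
have dl (i : 'I_3) (k : R) := is_deriveBf (dY i) (is_deriveMf (dY 2) (is_derive_cst k (0 : R) 1)).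
have := is_derive_near_cst (is_deriveDf (is_deriveMf (dl 0 e1) (dl 0 e1))
  (is_deriveMf (dl 1 e2) (dl 1 e2))).
move=> /(_ (r ^+ 2)) H.
have n2 : 2 * r != 0 by rewrite mulf_neq0 ?pnatr_eq0 ?gt_eqF.
apply: (mulfI n2); rewrite mulr0 -[RHS]H.
  by rewrite /= Y0 /x /vec3 !mxE /=; ring.
apply: (filterS _ (inv (z, v) setT filterT)) => t [q _ /=]; rewrite -xE => qE.
have := riemannX_cylinder a r q.1 q.2; rewrite qE -/(Y t) /cylinder /=.
by rewrite !subr0 -!expr2.
Qed.

(** Translations along the rulings preserve the cylinder, so tangency cannot control the axis point
    [p]. It is used only in combinations from which [p] drops out: the coefficient of z, and the
    part even in (c, s). *)
Lemma riemannX_not_rotational :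
  ~ rotational (fun q : R * R => riemannX a r q.1 q.2).
Proof.
move=> [p [d [G [_ rotG inv]]]].
have [K [K0 skew gen]] := rotational_cylinder_generator rotG inv.
pose b0 : 'rV[R]_3 := vec3 1 0 0; pose b1 : 'rV[R]_3 := vec3 0 1 0.
pose b2 : 'rV[R]_3 := vec3 0 0 1.
have K00 : K 0 0 = 0.
  by have := skew b0 b0; rewrite /lorentz !mulmx3E !vec3E; lra.
have K11 : K 1 1 = 0.
  by have := skew b1 b1; rewrite /lorentz !mulmx3E !vec3E; lra.
have K22 : K 2 2 = 0.
  by have := skew b2 b2; rewrite /lorentz !mulmx3E !vec3E; lra.
have K10 : K 1 0 = - K 0 1.
  by have := skew b0 b1; rewrite /lorentz !mulmx3E !vec3E; lra.
have K20 : K 2 0 = K 0 2.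
  by have := skew b0 b2; rewrite /lorentz !mulmx3E !vec3E; lra.
have K21 : K 2 1 = K 1 2.
  by have := skew b1 b2; rewrite /lorentz !mulmx3E !vec3E; lra.
pose h c s X0 X1 X2 := c * (- K 0 1 * X1 + K 0 2 * X2 - (K 0 2 * X0 + K 1 2 * X1) * e1)
  + s * (K 0 1 * X0 + K 1 2 * X2 - (K 0 2 * X0 + K 1 2 * X1) * e2).
have H z c s : c ^+ 2 + s ^+ 2 = 1 ->
    h c s (z * e1 + r * c - p 0 0) (z * e2 + r * s - p 0 1) (z - p 0 2) = 0.
  move=> cs; have := gen z c s cs; rewrite /= !mulmx3E K00 K11 K22 K10 K20 K21.
  by rewrite /vec3 !mxE /= => E; rewrite -[RHS]E /h; ring.
pose sg := K 0 2 * e1 + K 1 2 * e2.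
have ruling_fixed c s : c ^+ 2 + s ^+ 2 = 1 ->
    c * (K 0 2 - K 0 1 * e2 - sg * e1) + s * (K 0 1 * e1 + K 1 2 - sg * e2) = 0.
  move=> cs; have h0 := H 0 c s cs; have h1 := H 1 c s cs.
  transitivity (h c s (1 * e1 + r * c - p 0 0) (1 * e2 + r * s - p 0 1) (1 - p 0 2)
    - h c s (0 * e1 + r * c - p 0 0) (0 * e2 + r * s - p 0 1) (0 - p 0 2)).
    by rewrite /h /sg; ring.
  by rewrite h0 h1 subrr.
have quad c s : c ^+ 2 + s ^+ 2 = 1 -> (K 0 2 * c + K 1 2 * s) * (c * e1 + s * e2) = 0.
  move=> cs; have h0 := H 0 c s cs; have h1 : (- c) ^+ 2 + (- s) ^+ 2 = 1.
    by rewrite !sqrrN.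
  have {}h1 := H 0 (- c) (- s) h1.
  have r2 : - (2 * r) != 0 by rewrite oppr_eq0 mulf_neq0 ?pnatr_eq0 ?gt_eqF.
  apply: (mulfI r2); rewrite mulr0.
  transitivity (h c s (0 * e1 + r * c - p 0 0) (0 * e2 + r * s - p 0 1) (0 - p 0 2)
    + h (- c) (- s) (0 * e1 + r * - c - p 0 0) (0 * e2 + r * - s - p 0 1) (0 - p 0 2)).
    by rewrite /h; ring.
  by rewrite h0 h1 addr0.
have sg0 : sg = 0.
  by rewrite -[RHS](quad e1 e2 e_unit) -!expr2 e_unit mulr1.
have al : K 0 2 = K 0 1 * e2.
  have := ruling_fixed 1 0; rewrite sg0 expr1n expr0n addr0 => /(_ erefl); lra.
have be : K 1 2 = - K 0 1 * e1.
  have := ruling_fixed 0 1; rewrite sg0 expr1n expr0n add0r => /(_ erefl); lra.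
(* The unit vector is e turned by the angle of cosine 3/5 and sine 4/5, neither parallel nor
   orthogonal to e; there the product in [quad] equals - 12/25 times [K 0 1]. *)
have ka : K 0 1 = 0.
  have cs : ((3 * e1 - 4 * e2) / 5) ^+ 2 + ((3 * e2 + 4 * e1) / 5) ^+ 2 = 1.
    by transitivity (e1 ^+ 2 + e2 ^+ 2); [field|].
  have := quad _ _ cs; rewrite al be => E.
  have n : - (12 / 25) != 0 :> R by lra.
  apply: (mulIf n); rewrite mul0r -[RHS]E.
  transitivity (K 0 1 * - (12 / 25) * (e1 ^+ 2 + e2 ^+ 2) ^+ 2); last by field.
  by rewrite e_unit expr1n mulr1.
rewrite ka mul0r in al; rewrite ka oppr0 mul0r in be; rewrite ka oppr0 in K10.
rewrite al in K20; rewrite be in K21.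
case/eqP: K0; apply/matrixP => i j; rewrite mxE.
by case: (ord3P i) => ->; case: (ord3P j) => ->.
Qed.

End NotRotational.

(** * The explicit surface and the condition on a *)

Section RiemannSurface.
Context {R : realType}.

Lemma connected_plane : connected [set: R * R].
Proof.
rewrite (_ : [set: R * R] =
    \bigcup_(q in [set: R * R]) ((fun t : R => t *: q) @` [set: R])); last first.
  by apply/seteqP; split=> // q _; exists q => //; exists 1 => //; rewrite scale1r.
apply: bigcup_connected.
  by exists 0 => q _; exists 0 => //; rewrite scale0r.
move=> q _; apply: connected_continuous_connected.
  by apply/connected_intervalP.
apply: continuous_subspaceT => t.
by apply: cvgZ; [exact: cvg_id|exact: cvg_cst].
Qed.

Variables (a : 'rV[R]_2) (r : R).
Hypotheses (a0 : a != 0) (r0 : 0 < r).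
Let e1 := - r ^+ 2 * a 0 0.
Let e2 := - r ^+ 2 * a 0 1.
Let X (q : R * R) := riemannX a r q.1 q.2.

Lemma riemannX_unit :
  r ^+ 2 * Num.sqrt (a 0 0 ^+ 2 + a 0 1 ^+ 2) = 1 <-> e1 ^+ 2 + e2 ^+ 2 = 1.
Proof.
set s := _ + a 0 1 ^+ 2; have s0 : 0 <= s by rewrite addr_ge0 ?sqr_ge0.
have -> : e1 ^+ 2 + e2 ^+ 2 = (r ^+ 2 * Num.sqrt s) ^+ 2.
  by rewrite [RHS]exprMn sqr_sqrtr // /e1 /e2 /s; ring.
split=> [->|/eqP]; first by rewrite expr1n.
have p : 0 <= r ^+ 2 * Num.sqrt s.
  by apply: mulr_ge0; [exact: sqr_ge0|exact: sqrtr_ge0].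
by rewrite -[X in _ == X](expr1n _ 2) eqrXn2 // => /eqP.
Qed.

Lemma riemannX_zmc_unit : zero_mean_curvature X [set id_chart R] ->
  e1 ^+ 2 + e2 ^+ 2 = 1.
Proof.
move=> zmc; pose n := e1 ^+ 2 + e2 ^+ 2.
have n0 : 0 < n.
  rewrite lt0r addr_ge0 ?sqr_ge0 // andbT paddr_eq0 ?sqr_ge0 // !sqrf_eq0.
  rewrite !mulf_eq0 oppr_eq0 sqrf_eq0 (gt_eqF r0) /=.
  apply: contraNN a0 => /andP[/eqP z0 /eqP z1]; apply/eqP/rowP => i.
  by rewrite mxE; case: i => -[|[|//]] hi; [rewrite -z0|rewrite -z1]; congr (a _ _);
    exact: val_inj.
have rn0 : r != 0 by rewrite gt_eqF.
have sn := sqr_sqrtr (ltW n0).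
have sq0 : 0 < Num.sqrt n by rewrite sqrtr_gt0.
(* Where y is orthogonal to e, EG - F^2 = - r^2 whatever the length of e, so H = 0 may be used; it
   reads r^2 (n - 1) = 0. *)
have [|v [cv sv]] := polar_angle sq0 (y1 := - e2) (y2 := e1).
  by rewrite sn /n sqrrN addrC.
have [xu xv xuu xuv xvv] := riemannX_partials a r 0 v.
have cs := cos2Dsin2 v.
have q0 : Num.sqrt n != 0 by rewrite gt_eqF // sqrtr_gt0.
have ew : e1 * cos v + e2 * sin v = 0.
  by apply: (mulfI q0); rewrite mulr0 mulrDr !(mulrCA (Num.sqrt n)) -cv -sv; ring.
have ge : gram (vec3 e1 e2 1) (vec3 (- r * sin v) (r * cos v) 0) = - r ^+ 2.
  transitivity (r ^+ 2 * ((e1 * cos v + e2 * sin v) ^+ 2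
    - (cos v ^+ 2 + sin v ^+ 2))); last by rewrite ew cs; ring.
  by rewrite /gram /lorentz !vec3E; ring.
have E : in_chart X (id_chart R) = riemannX a r by [].
have nd : gram (du (riemannX a r) 0 v) (dv (riemannX a r) 0 v) != 0.
  by rewrite xu xv ge oppr_eq0 sqrf_eq0.
have := zmc (id_chart R) 0 v erefl (conj I I).
rewrite E => /(_ (gram_nondegenerate nd))/(mean_curvature_eq0 nd).
rewrite xu xv xuu xuv xvv => H.
have : r ^+ 2 * (n - 1) = 0.
  transitivity (r ^+ 2 * (cos v ^+ 2 + sin v ^+ 2) * (n - 1)).
    by rewrite cs mulr1.
  rewrite -[RHS]H /mc_form /triple /lorentz /lcross !vec3E !mxE /n /e1 /e2; ring.
move/eqP; rewrite mulf_eq0 sqrf_eq0 (negbTE rn0) /= subr_eq0 => /eqP.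
by [].
Qed.

Lemma riemannX_immersive : immersive_chart X (id_chart R).
Proof.
split.
- by split; rewrite //=; exact: openT.
- split.
  + move=> [u v] _; rewrite /= (_ : (fun q => _) = id); last first.
      by apply/funext => -[].
    exact: cvg_id.
  + by move=> [u v] [u' v'] _ _ /= [-> ->].
  + move=> O oO _; rewrite (_ : _ @` O = O) //.
    rewrite (_ : (fun q => _) = id) ?image_id //.
    by apply/funext => -[].
- exact: riemannX_smooth.
- by move=> u v _; exact: riemannX_regular.
Qed.

Hypothesis e_unit : e1 ^+ 2 + e2 ^+ 2 = 1.

Lemma riemannX_zmc_example :
  riemann_zmc_example X [set id_chart R] (vec3 0 0 1) (fun=> r).
Proof.
split.
- split.
  + exact: norm_hausdorff.
  + exact: connected_plane.
  + by move=> _ ->; exact: riemannX_immersive.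
  + by move=> [u v]; exists (id_chart R) => //; exists (u, v).
- exact: riemannX_not_rotational.
- move=> _ u v -> _ _; apply: mc_form_mean_curvature.
  have -> : in_chart X (id_chart R) = riemannX a r by [].
  have [-> -> -> -> ->] := riemannX_partials a r u v.
  (* Second derivatives involving u vanish, so [mc_form] keeps only the term with the factor <xu,
     xu>, and [xu] is the lightlike ruling. *)
  have e11 : e1 * e1 = 1 - e2 * e2 by rewrite -e_unit; ring.
  rewrite /mc_form /triple /lorentz /lcross !vec3E -/e1 -/e2 e11 !mxE; ring.
- move=> [u v]; exists (id_chart R); split=> //; first by exists (u, v).
  move=> u' _; exists (u' *: vec3 e1 e2 1), r; split=> // v' _; split=> //.
  rewrite /circle /= /in_chart /= /X /riemannX /= -/e1 -/e2 addrC addKr.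
  split; rewrite /lorentz /vec3 !mxE /=; first by ring.
  transitivity (r ^+ 2 * (cos v' ^+ 2 + sin v' ^+ 2)); first by ring.
  by rewrite cos2Dsin2 mulr1.
Qed.

End RiemannSurface.

(** The second clause cuts the family down: centres advance by e = - r^2 a per unit of height, and
    for nonzero a the mean curvature vanishes only if these rulings are lightlike, that is |e| =
    1. *)
Theorem proposition3p2 (R : realType) :
  (forall (M : topologicalType) (f : M -> 'rV[R]_3) (A : set (chart R M))
      (nu : 'rV[R]_3) (rad : M -> R) (r : R),
    0 < r ->
    spacelike (orthogonal_plane nu) ->
    riemann_zmc_example f A nu rad ->
    (forall m, rad m = r) ->
    exists (a : 'rV[R]_2) (Phi : 'rV[R]_3 -> 'rV[R]_3)
        (L1 L2 : set 'rV[R]_3),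
      [/\ a != 0, rigid_motion Phi,
          forall m, exists z v, Phi (f m) = riemannX a r z v,
          timelike_extended_to_lines (riemannX a r) L1 L2 &
          forall phi u v, A phi -> chart_dom phi (u, v) ->
            ((L1 `|` L2) (Phi (in_chart f phi u v)) ->
               degenerate (tangent (in_chart f phi) u v)) /\
            (~ (L1 `|` L2) (Phi (in_chart f phi u v)) ->
               timelike (tangent (in_chart f phi) u v))])
  /\
  (forall (a : 'rV[R]_2) (r : R), a != 0 -> 0 < r ->
    riemann_zmc_example (fun q : R * R => riemannX a r q.1 q.2)
      [set id_chart R] (vec3 0 0 1) (fun=> r)
    <-> r ^+ 2 * Num.sqrt (a 0 0 ^+ 2 + a 0 1 ^+ 2) = 1).
Proof.
split.
  move=> M f A nu rad r r0 sp ex radr.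
  exact: riemann_zmc_classification r0 sp ex radr.
move=> a r a0 r0; split.
  by case=> _ _ zmc _; apply/riemannX_unit; exact: riemannX_zmc_unit a0 r0 zmc.
by move/riemannX_unit => e; exact: riemannX_zmc_example.
Qed.
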